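(* Let $F$ be a matching of size $k$ in a graph $G$, and let $\mathcal{P}$ be a family (repetitions allowed) of $F$-augmenting alternating paths in $G$. Suppose there is no $\mathcal{P}$-rainbow $F$-augmenting alternating path. Then (1) $|\mathcal{P}| \le 2k$, and (2) if $|\mathcal{P}| = 2k$, then $\mathcal{P}$ is a $k$-badge.
   Context: Paths are identified with their edge sets. Given a matching $F$, a simple path is $F$-alternating if every other edge of it belongs to $F$; an $F$-augmenting alternating path ($F$-AAP) is an $F$-alternating path both of whose endpoints are not covered by $F$ (so its first and last edges are not in $F$). For an indexed family $\mathcal{S}=(S_1,\ldots,S_m)$ of edge sets, a set $X$ is $\mathcal{S}$-rainbow if there is an injective map $\phi: X \to \{1,\ldots,m\}$ with $x \in S_{\phi(x)}$ for all $x\in X$; an $F$-AAP is $\mathcal{S}$-rainbow if its set of non-$F$ edges is $\mathcal{S}$-rainbow. For $m \ge 1$, an $m$-origamistrip $OS$ with endpoints $x,y$ is a graph on distinct vertices $u_1,\ldots,u_m,v_1,\ldots,v_m,x,y$ whose edge set is the union of the disjoint matchings $M(OS)=\{u_1v_1,\ldots,u_mv_m\}$ (the skeleton), $A(OS)=\{xu_1, v_1u_2, \ldots, v_{m-1}u_m, v_my\}$ and $B(OS)=\{xv_1, u_1v_2, \ldots, u_{m-1}v_m, u_my\}$; the $u_i,v_i$ are its interior vertices. Let $P^A(OS)=A(OS)\cup M(OS)$, $P^B(OS)=B(OS)\cup M(OS)$. A badge is a family of paths obtained from a loopless multigraph $H$ and a positive integer weighting $w$ of $E(H)$: for each edge $e=xy$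 of $H$ take a $w(e)$-origamistrip $OS(e)$ with endpoints $x,y$, the interior vertex sets of the different $OS(e)$ being pairwise disjoint and disjoint from $V(H)$; the badge is the family consisting of $P^A(OS(e))$ and $P^B(OS(e))$, each repeated $w(e)$ times, over all $e\in E(H)$. Its skeleton is $\bigcup_e M(OS(e))$, and it is a $k$-badge where $k=\sum_e w(e)$. *)

(* Defs.v *)
From mathcomp Require Import all_boot.

Set Implicit Arguments.
Unset Strict Implicit.
Unset Printing Implicit Defensive.

Record sgraph (V : finType) := SGraph {
  adj :> rel V;
  adj_sym : symmetric adj;
  adj_irrefl : irreflexive adj
}.

Section Paths.
Variable V : finType.
Implicit Types (G : sgraph V) (F X : {set {set V}}).

(* Edges are two-element vertex sets; a vertex is covered by F when it belongs
   to cover F. *)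
Definition edges G : {set {set V}} :=
  [set [set z.1; z.2] | z in [pred z : V * V | G z.1 z.2]].

Definition matching G F : bool := (F \subset edges G) && trivIset F.

(* The edges of the walk x :: p, in order. *)
Definition walk_edges (x : V) (p : seq V) : seq {set V} :=
  pairmap (fun a b => [set a; b]) x p.

Definition simple_path G (x : V) (p : seq V) : bool :=
  path G x p && uniq (x :: p).

(* Of any two consecutive edges exactly one lies in F. *)
Definition alternating F (x : V) (p : seq V) : bool :=
  sorted (fun e e' => (e \in F) != (e' \in F)) (walk_edges x p).

(* X is the edge set of an F-augmenting alternating path. The one-vertex path
   is excluded: an F-AAP has a first edge. *)
Definition is_aap G F X : Prop :=
  exists (x : V) (p : seq V),
    [/\ p != [::], simple_path G x p, alternating F x p,
        (x \notin cover F) && (last x p \notin cover F)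
      & X = [set:: walk_edges x p]].

(* phi only matters on X, so it may be taken total with values in nat. *)
Definition rainbow (S : seq {set {set V}}) X : Prop :=
  exists phi : {set V} -> nat,
    {in X &, injective phi} /\
    {in X, forall e, phi e < size S /\ e \in nth set0 S (phi e)}.

Definition rainbow_aap G F (S : seq {set {set V}}) X : Prop :=
  is_aap G F X /\ rainbow S (X :\: F).

End Paths.

(* os_u and os_v are only meaningful at the indices 1, ..., os_len. *)
Record origamistrip (V : finType) := OrigamiStrip {
  os_len : nat;
  os_x : V;
  os_y : V;
  os_u : nat -> V;
  os_v : nat -> V;
  os_len_gt0 : 0 < os_len;
  os_uniq : uniq (map os_u (iota 1 os_len) ++ map os_v (iota 1 os_len)
                  ++ [:: os_x; os_y])
}.

Section Strips.
Variables (V : finType) (S : origamistrip V).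
Let m := os_len S.
Let x := os_x S.
Let y := os_y S.
Let u := os_u S.
Let v := os_v S.

Definition os_interior : {set V} :=
  [set:: map u (iota 1 m) ++ map v (iota 1 m)].

Definition os_M : {set {set V}} := \bigcup_(1 <= i < m.+1) [set [set u i; v i]].

Definition os_A : {set {set V}} :=
  [set x; u 1] |: ([set v m; y] |:
    \bigcup_(1 <= i < m) [set [set v i; u i.+1]]).

Definition os_B : {set {set V}} :=
  [set x; v 1] |: ([set u m; y] |:
    \bigcup_(1 <= i < m) [set [set u i; v i.+1]]).

Definition os_PA : {set {set V}} := os_A :|: os_M.
Definition os_PB : {set {set V}} := os_B :|: os_M.

End Strips.

(* A finite loopless multigraph whose vertices are taken in V. *)
Record multigraph (V : finType) := Multigraph {
  mg_vertices : {set V};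
  mg_edge : finType;
  mg_ends : mg_edge -> {set V};
  mg_ends_sub : forall e, mg_ends e \subset mg_vertices;
  mg_loopless : forall e, #|mg_ends e| = 2
}.

Section Badges.
Variable V : finType.

Definition badge_strips (H : multigraph V) (w : mg_edge H -> nat)
    (OS : mg_edge H -> origamistrip V) : Prop :=
  [/\ forall e, os_len (OS e) = w e,
      forall e, [set os_x (OS e); os_y (OS e)] = mg_ends e,
      forall e e', e != e' ->
        [disjoint os_interior (OS e) & os_interior (OS e')]
    & forall e, [disjoint os_interior (OS e) & mg_vertices H]].

Definition badge_family (H : multigraph V) (w : mg_edge H -> nat)
    (OS : mg_edge H -> origamistrip V) : seq {set {set V}} :=
  flatten [seq nseq (w e) (os_PA (OS e)) ++ nseq (w e) (os_PB (OS e))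
             | e <- enum (mg_edge H)].

(* Families are compared up to reindexing, with multiplicities. *)
Definition is_badge (k : nat) (P : seq {set {set V}}) : Prop :=
  exists (H : multigraph V) (w : mg_edge H -> nat)
         (OS : mg_edge H -> origamistrip V),
    [/\ forall e, 0 < w e, badge_strips w OS,
        perm_eq P (badge_family w OS) & \sum_e w e = k].

End Badges.

(* Main.v *)
Require Import Defs.
From mathcomp Require Import all_boot.
From Stdlib Require Import Classical.

(* Replace F by its mate involution f, whose fixed points, the roots, are the
   uncovered vertices. Let J be a set of links (non-F edges) containing no
   augmenting path, and call a vertex reachable if an even alternating path leads
   to it from a root. If S is any augmenting path, then adding some link of S to
   J creates an augmenting path or a new reachable vertex (theorem [growth]):
   induct on the number of edges of F, by contracting an odd cycle through a
   root x, or, if a link x - c has c unreachable, by deleting c and making f c a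
   root. Adding links of new colours one at a time, each colour thus gains a
   reachable vertex among the 2k covered ones, which gives (1).

   If there are exactly 2k colours, all covered vertices become reachable, so
   there is a rainbow odd cycle through a root, and counting shows that it is a
   triangle x, a, f a. Contracting it and dropping its two colours leaves, by
   induction, a badge with k - 1 skeleton edges. A badge is determined by all its
   members but one; exchanging the two dropped colours against other members,
   this shows that the members starting x, a all agree, as do those starting
   x, f a, and that together they extend one strip at x by the edge {a, f a}. *)

Set Implicit Arguments.
Unset Strict Implicit.
Unset Printing Implicit Defensive.

(** * Alternating paths for an involution *)

(** Contraction is harmless for the reason known from blossom algorithms: an odd cycle through [x]
    can be run through both ways, so each of its covered vertices is reachable from [x] inside the
    cycle, and a path leaving the cycle anywhere can be prolonged back to [x]. If instead [c] is
    unreachable, no path from a root can enter the edge [c], [f c] at [f c]; every path enters it at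
    [c], and [f c] can act as a root of its own. The links of [J] carry distinct colours, so an
    augmenting path inside [J] would be rainbow. Hence the first outcome of the growth theorem never
    occurs, and every colour pays with a vertex. For (2), two colours are set aside at a triangle
    because a rainbow path of the contraction, when lifted, may need the link from [x] to [a] or the
    one to [f a]; this also matches the loss of two covered vertices. The obstacle is that a member
    crossing the triangle has no canonical contraction, since a piece remains on each side. The
    induction applies to every choice of pieces and of the two colours, and badges sharing all
    members but one must agree; comparing choices gives the structure at the triangle. *)

Section Dipaths.
Variable V : finType.
Implicit Types (f g : V -> V) (p q u v w c : V) (cs s : seq V) (l : V * V).

Definition swap l : V * V := (l.2, l.1).

(* The alternating path p - c1 = f c1 - c2 = f c2 - ... - q is encoded by [p],
   [q] and the list of the [ci], the vertices at which it enters an edge of the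
   matching; [links] lists its other edges. *)
Fixpoint links f p cs q : seq (V * V) :=
  if cs is c :: cs' then (p, c) :: links f (f c) cs' q else [:: (p, q)].

Definition touch f cs v := (v \in cs) || (f v \in cs).

(* A fixed point of [f] in [cs] would be repeated, so [valid] also says that all
   vertices of [cs] are covered. *)
Definition valid f cs := uniq (cs ++ map f cs).

Lemma swapK : involutive swap.
Proof. by case. Qed.

Lemma links_cat f p s1 c s2 q :
  links f p (s1 ++ c :: s2) q = links f p s1 c ++ links f (f c) s2 q.
Proof. by elim: s1 p => //= d s1 IH p; rewrite IH. Qed.

Lemma links_rcons f p s c q :
  links f p (rcons s c) q = rcons (links f p s c) (f c, q).
Proof. by rewrite -cats1 links_cat cats1. Qed.

Lemma links_rev f p cs q : involutive f ->
  links f q (rev (map f cs)) p = rev (map swap (links f p cs q)).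
Proof.
move=> fK; elim: cs p => //= c cs IH p.
by rewrite !rev_cons links_rcons IH fK.
Qed.

Lemma links_fst f p cs q : map fst (links f p cs q) = p :: map f cs.
Proof. by elim: cs p => //= c cs IH p; rewrite IH. Qed.

Lemma links_snd f p cs q : map snd (links f p cs q) = rcons cs q.
Proof. by elim: cs p => //= c cs IH p; rewrite IH. Qed.

Lemma size_links f p cs q : size (links f p cs q) = (size cs).+1.
Proof. by elim: cs p => //= c cs IH p; rewrite IH. Qed.

Lemma eq_in_links f g p cs q :
  {in cs, f =1 g} -> links f p cs q = links g p cs q.
Proof.
elim: cs p => //= c cs IH p e; rewrite e ?mem_head // IH // => d dcs.
by rewrite e // inE dcs orbT.
Qed.

Lemma linksP f p cs q l : l \in links f p cs q ->
  l.1 \in p :: map f cs /\ l.2 \in rcons cs q.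
Proof. by move=> h; rewrite -(links_fst f p cs q) -(links_snd f p cs q) !map_f. Qed.

Lemma links_last_mem f p cs q : (last p (map f cs), q) \in links f p cs q.
Proof. by elim: cs p => /= [|c cs IH] p; rewrite inE ?eqxx // IH orbT. Qed.

(** Only the last link depends on the end of the path, so a path can be redirected at its last
    vertex without recolouring the rest. *)
Lemma links_lastE f p cs q : exists2 ls,
  links f p cs q = rcons ls (last p (map f cs), q) &
  forall r, links f p cs r = rcons ls (last p (map f cs), r).
Proof.
elim: cs p => [|c cs IH] p /=; first by exists [::].
have [ls h1 h2] := IH (f c); exists ((p, c) :: ls) => [|r]; first by rewrite h1.
by rewrite h2.
Qed.

Section Involution.
Variable f : V -> V.
Hypothesis fK : involutive f.

Lemma touchf cs v : touch f cs (f v) = touch f cs v.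
Proof. by rewrite /touch fK orbC. Qed.

Lemma mem_map_inv cs v : (v \in map f cs) = (f v \in cs).
Proof. by rewrite -{1}(fK v) (mem_map (inv_inj fK)). Qed.

Lemma valid_cons c cs :
  valid f (c :: cs) = [&& f c != c, ~~ touch f cs c & valid f cs].
Proof.
have e: uniq (cs ++ f c :: map f cs) = uniq (f c :: cs ++ map f cs).
  by rewrite -[f c :: map f cs]cat1s uniq_catCA.
rewrite /valid /touch map_cons cat_cons /= e /= !mem_cat !inE !(mem_map_inv) fK.
rewrite !negb_or (eq_sym c).
by case: (f c == c); case: (c \in cs); case: (f c \in cs); rewrite ?andbF ?andbT.
Qed.

Lemma valid_cat s1 s2 :
  valid f (s1 ++ s2) = [&& valid f s1, valid f s2 & ~~ has (touch f s2) s1].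
Proof.
elim: s1 => [|c s1 IH] /=; first by rewrite andbT.
rewrite !valid_cons IH /touch !mem_cat !negb_or.
by case: (f c == c); case: (c \in s1); case: (f c \in s1); case: (c \in s2);
   case: (f c \in s2); case: (valid f s1); case: (valid f s2).
Qed.

Lemma valid_rcons s c : valid f (rcons s c) = valid f (c :: s).
Proof.
have e : has (touch f [:: c]) s = touch f s c.
  apply/hasP/orP => [[x xs]|[h|h]].
  - by rewrite /touch !inE => /orP[/eqP<-|/eqP<-]; rewrite ?fK; [left|right].
  - by exists c => //; rewrite /touch inE eqxx.
  - by exists (f c) => //; rewrite /touch !inE fK eqxx orbT.
rewrite -cats1 valid_cat !valid_cons e /=.
by case: (f c != c); case: (valid f s); case: (touch f s c).
Qed.

Lemma valid_active cs v : valid f cs -> touch f cs v -> f v != v.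
Proof.
elim: cs => [|c cs IH] //; rewrite valid_cons => /and3P[h _ hv].
rewrite /touch !inE => /orP[/orP[/eqP->//|m]|/orP[/eqP m|m]]; try
  by apply: IH => //; rewrite /touch m ?orbT.
by apply: contra h => /eqP e; rewrite -m fK e.
Qed.

Lemma valid_notin cs v : valid f cs -> f v = v -> v \notin cs.
Proof.
move=> hv fv; apply/negP => m; have := valid_active hv (v := v).
by rewrite /touch m fv eqxx => /(_ isT).
Qed.

Lemma touch_rev cs v : touch f (rev (map f cs)) v = touch f cs v.
Proof. by rewrite /touch !mem_rev !mem_map_inv fK orbC. Qed.

Lemma touch_map cs v : touch f (map f cs) v = touch f cs v.
Proof. by rewrite /touch !mem_map_inv fK orbC. Qed.

Lemma touch_cat s1 s2 v : touch f (s1 ++ s2) v = touch f s1 v || touch f s2 v.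
Proof. by rewrite /touch !mem_cat orbACA. Qed.

Lemma valid_map cs : valid f (map f cs) = valid f cs.
Proof.
by elim: cs => //= c cs IH; rewrite !valid_cons touch_map touchf IH fK eq_sym.
Qed.

Lemma valid_rev cs : valid f (rev cs) = valid f cs.
Proof. by rewrite /valid map_rev -rev_cat rev_uniq uniq_catC. Qed.

Lemma links_uniq p cs q : valid f cs -> f p = p -> f q = q -> p != q ->
  uniq (map fst (links f p cs q) ++ map snd (links f p cs q)).
Proof.
move=> hv fp fq pq; rewrite links_fst links_snd /= -cats1 catA mem_cat mem_cat !inE.
rewrite mem_map_inv fp (negPf (valid_notin hv fp)) (negPf pq) /=.
rewrite uniq_catC /= mem_cat mem_map_inv fq (negPf (valid_notin hv fq)) /=.
by rewrite uniq_catC.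
Qed.

Lemma all_links_rev (J : pred (V * V)) p cs q : (forall l, J (swap l) = J l) ->
  all J (links f q (rev (map f cs)) p) = all J (links f p cs q).
Proof.
by move=> Js; rewrite links_rev // all_rev all_map; apply: eq_all => l /=.
Qed.

Lemma valid_flip cs : valid f (rev (map f cs)) = valid f cs.
Proof. by rewrite valid_rev valid_map. Qed.

End Involution.

(** * Turning covered vertices into fixed points *)

Section Freeze.
Variables (f : V -> V) (S : {set V}).
Hypotheses (fK : involutive f) (fS : forall v, (f v \in S) = (v \in S)).

(** Deletion and contraction keep the vertex type: the vertices concerned become roots, and the
    accompanying change of the link set isolates those that should disappear. *)
Definition freeze v := if v \in S then v else f v.

Lemma freezeK : involutive freeze.
Proof.
move=> v; rewrite /freeze; case vS: (v \in S); first by rewrite vS.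
by rewrite fS vS fK.
Qed.

Lemma freeze_fixP v : freeze v = v -> v \in S \/ f v = v.
Proof. by rewrite /freeze; case: (v \in S); [left|right]. Qed.

Lemma freeze_notin v : v \notin S -> freeze v = f v.
Proof. by rewrite /freeze => /negPf ->. Qed.

Lemma valid_freezeP cs :
  valid freeze cs <-> valid f cs /\ {in cs, forall v, v \notin S}.
Proof.
have e : {in cs, forall v, v \notin S} -> map freeze cs = map f cs.
  by move=> h; apply/eq_in_map => v /h; apply: freeze_notin.
split=> [hv|[hv h]]; last by rewrite /valid e.
have h : {in cs, forall v, v \notin S}.
  move=> v vcs; have := valid_active freezeK hv (v := v).
  by rewrite /touch vcs => /(_ isT); apply: contra => vS; rewrite /freeze vS.
by split=> //; rewrite /valid -e.
Qed.

Lemma links_freeze p cs q :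
  {in cs, forall v, v \notin S} -> links freeze p cs q = links f p cs q.
Proof. by move=> h; apply: eq_in_links => v /h; apply: freeze_notin. Qed.

Lemma active_freeze v : (freeze v != v) = (f v != v) && (v \notin S).
Proof. by rewrite /freeze; case: (v \in S); rewrite ?eqxx ?andbF ?andbT. Qed.

Lemma card_active_freeze : {in S, forall v, f v != v} ->
  #|[pred v | f v != v]| = #|[pred v | freeze v != v]| + #|S|.
Proof.
move=> h; rewrite -(cardID [pred v | v \in S] [pred v | f v != v]) addnC.
congr addn; apply: eq_card => v; rewrite !inE ?active_freeze 1?andbC //.
by case vS: (v \in S) => //=; rewrite h.
Qed.

End Freeze.

(** * Growth of the set of reachable vertices *)

Section Growth.
Implicit Types (J : pred (V * V)).

Definition symmetric_links J := forall l, J (swap l) = J l.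

Definition augmentable f J := exists p cs q,
  [/\ f p = p, f q = q, p != q, valid f cs & all J (links f p cs q)].

(** The last node is [f v], so the path arrives at [v] along a matching edge. Validity makes [v]
    covered: roots do not count as reachable, which gives the bound by the number of covered
    vertices. *)
Definition reachable f J v := exists p cs,
  [/\ f p = p, valid f (rcons cs (f v)) & all J (links f p cs (f v))].

Definition add_link J l : pred (V * V) :=
  [pred l' | [|| J l', l' == l | swap l' == l]].

Lemma add_link_sym J l : symmetric_links J -> symmetric_links (add_link J l).
Proof.
by move=> Js l'; rewrite /add_link !inE Js swapK; case: (J l') => //=; rewrite orbC.
Qed.

Lemma sub_add_link J l : subpred J (add_link J l).
Proof. by move=> l' h; apply/orP; left. Qed.

Lemma augmentable_sub f J J' : subpred J J' -> augmentable f J -> augmentable f J'.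
Proof.
move=> sJ [p [cs [q [h1 h2 h3 h4 h5]]]]; exists p, cs, q; split=> //.
exact: sub_all h5.
Qed.

Lemma reachable_sub f J J' v : subpred J J' -> reachable f J v -> reachable f J' v.
Proof.
move=> sJ [p [cs [h1 h2 h3]]]; exists p, cs; split=> //; exact: sub_all h3.
Qed.

(** * Deletion of an unreachable vertex *)

Section DeleteInner.
Variables (f : V -> V) (fK : involutive f) (x c : V).
Hypotheses (fx : f x = x) (fc : f c != c).
Let S : {set V} := [set c; f c].
(** Freezing the pair turns [c] into a root as well; without links it is isolated, and only [f c] is
    a new root of interest. *)
Definition avoid J : pred (V * V) := [pred l | [&& J l, l.1 != c & l.2 != c]].

Let fS v : (f v \in S) = (v \in S).
Proof.
rewrite !inE (inj_eq (inv_inj fK)) orbC; congr orb.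
by apply/eqP/eqP => [<-|->]; rewrite fK.
Qed.

(** A path using the new root [f c] is prolonged by the link from [x] to [c] and the matching edge.
    This fails only if its other end is [x]; then, read from [x], it arrives at [f c] and so reaches
    [c]. *)
Lemma augmentable_delete J : symmetric_links J -> J (x, c) ->
  augmentable (freeze f S) (avoid J) -> augmentable f J \/ reachable f J c.
Proof.
move=> Js Jxc [p [cs [q [hp hq pq /(valid_freezeP fK fS)[hv hS] hJ]]]].
rewrite (links_freeze _ _ _ hS) in hJ.
have hJ' : all J (links f p cs q) by apply: sub_all hJ => l /and3P[].
have [pc _] : p != c /\ true.
  by split=> //; case: (cs) hJ => [|d s] /= /andP[/and3P[]].
have qc : q != c by have /(allP hJ) /and3P[] := links_last_mem f p cs q.
have key a s b : f b = b -> b != f c -> valid f s -> {in s, forall v, v \notin S} ->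
    all J (links f a s b) -> a = f c -> augmentable f J \/ reachable f J c.
  move=> fb bc vs sS aJ e; have vcs : valid f (c :: s).
    rewrite valid_cons // fc vs andbT /touch /= negb_or.
    apply/andP; split; apply/negP => /sS; by rewrite !inE eqxx ?orbT.
  have [xb|xb] := eqVneq x b; last first.
    by left; exists x, (c :: s), b; split=> //=; rewrite Jxc -e.
  right; exists x, (rev (map f s)); split=> //; last first.
    by rewrite -xb e in aJ; rewrite all_links_rev.
  move: vcs; rewrite valid_rcons // !valid_cons // fK (eq_sym c).
  by rewrite touchf // touch_rev // valid_flip.
have out a : freeze f S a = a -> a != c -> a != f c -> f a = a.
  by move=> /freeze_fixP[] //; rewrite !inE => /orP[->|->].
have [pe|pf] := eqVneq p (f c).
  have qe : q != f c by rewrite -pe eq_sym.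
  apply: (key p cs q) => //; exact: out.
have [qe|qf] := eqVneq q (f c).
  apply: (key q (rev (map f cs)) p) => //; first exact: out.
  - by rewrite valid_flip.
  - by move=> v; rewrite mem_rev mem_map_inv // => /hS; rewrite fS.
  - by rewrite all_links_rev.
by left; exists p, cs, q; split=> //; apply: out.
Qed.

Lemma reachable_delete J v : J (x, c) ->
  reachable (freeze f S) (avoid J) v -> reachable f J v.
Proof.
move=> Jxc [p [cs [hp /(valid_freezeP fK fS)[hv hS] hJ]]].
have vS : v \notin S.
  apply/negP => vS; have := hS (freeze f S v).
  by rewrite mem_rcons mem_head /freeze vS => /(_ isT); rewrite vS.
rewrite (freeze_notin _ vS) in hv hS hJ.
have hcs : {in cs, forall v, v \notin S} by move=> w h; rewrite hS // mem_rcons inE h orbT.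
rewrite (links_freeze _ _ _ hcs) in hJ.
have hJ' : all J (links f p cs (f v)) by apply: sub_all hJ => l /and3P[].
have pc : p != c by case: (cs) hJ => [|d s] /= /andP[/and3P[]].
case: (freeze_fixP hp) => [|fp]; last by exists p, cs.
rewrite !inE (negPf pc) /= => /eqP e; exists x, (c :: cs); split=> //=.
  rewrite valid_cons // fc hv andbT /touch negb_or /=.
  by apply/andP; split; apply/negP => /hS; rewrite !inE eqxx ?orbT.
by rewrite Jxc -e.
Qed.

(** A path that meets the pair must enter it at [c], for entering at [f c] would reach [c]. Its part
    from [f c] on starts at a root of the reduced instance. *)
Lemma reachable_delete_inv J v : ~ reachable f J c -> v \notin S ->
  reachable f J v -> reachable (freeze f S) (avoid J) v.
Proof.
move=> nrc vS [p [cs [fp hv hJ]]].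
have fvS : f v \notin S by rewrite fS.
have pS : p \notin S.
  rewrite !inE negb_or; apply/andP; split; apply: contra fc => /eqP e.
    by rewrite -e fp.
  by rewrite -[in f c]e -[c]fK -e fp.
have frv : freeze f S v = f v by rewrite freeze_notin.
have key a s : a != c -> valid f (rcons s (f v)) -> {in s, forall w, w \notin S} ->
    freeze f S a = a ->
    all J (links f a s (f v)) -> reachable (freeze f S) (avoid J) v.
  move=> ac vs sS fa aJ; have sS' : {in rcons s (f v), forall w, w \notin S}.
    by move=> w; rewrite mem_rcons inE => /orP[/eqP->//|/sS].
  exists a, s; rewrite frv; split=> //; first exact/valid_freezeP.
  rewrite links_freeze //; apply/allP => l hl; rewrite /avoid inE (allP aJ) //=.
  have [h1 h2] := linksP hl; apply/andP; split.
    move: h1; rewrite inE => /orP[/eqP->//|]; rewrite mem_map_inv // => /sS.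
    by rewrite fS; apply: contra => /eqP->; rewrite !inE eqxx.
  by move/sS': h2; apply: contra => /eqP->; rewrite !inE eqxx.
case: (boolP (touch f cs c)) => [/orP[]/splitPr e|].
- case: e hv hJ => l1 l2; rewrite links_cat all_cat rcons_cat rcons_cons valid_cat //.
  case/and3P=> _; rewrite valid_cons // => /and3P[_ + hv] _ /andP[_ hJ].
  rewrite /touch !mem_rcons !inE !negb_or => /andP[/andP[_ h1] /andP[_ h2]].
  apply: (key (f c) l2) => //.
    move=> w wl2; rewrite !inE negb_or.
    by apply/andP; split; [apply: contra h1|apply: contra h2] => /eqP<-.
  by rewrite /freeze !inE eqxx orbT.
- case: e hv hJ => l1 l2; rewrite links_cat all_cat => hv /andP[hJ _]; case: nrc.
  exists p, l1; split=> //; move: hv; rewrite rcons_cat rcons_cons -cat_rcons.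
  by rewrite valid_cat // => /and3P[].
rewrite /touch negb_or => /andP[h1 h2]; apply: (key p cs) => //.
- by apply: contra pS => /eqP->; rewrite !inE eqxx.
- move=> w ws; rewrite !inE negb_or.
  by apply/andP; split; [apply: contra h1|apply: contra h2] => /eqP<-.
- by rewrite freeze_notin.
Qed.

End DeleteInner.

(** * Contraction of an odd cycle into a root *)

Section Contract.
Variables (f : V -> V) (fK : involutive f) (x : V) (S : {set V}).
Hypotheses (fx : f x = x) (fS : forall v, (f v \in S) = (v \in S)).
Hypothesis S_active : {in S, forall v, f v != v}.

Definition collapse v := if v \in S then x else v.
Definition collapse2 l := (collapse l.1, collapse l.2).
Definition image_links J : pred (V * V) :=
  [pred l | [exists l0, J l0 && (collapse2 l0 == l)]].

Lemma root_notin v : f v = v -> v \notin S.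
Proof. by move=> fv; apply/negP => /S_active; rewrite fv eqxx. Qed.

Let xS : x \notin S. Proof. exact: root_notin. Qed.

Lemma collapse_notin v : v \notin S -> collapse v = v.
Proof. by rewrite /collapse => /negPf->. Qed.

Lemma collapse_out v : collapse v \notin S.
Proof. by rewrite /collapse; case: ifP => // ->. Qed.

Lemma collapse_neq v w : w != x -> collapse v = w -> v = w.
Proof. by rewrite /collapse; case: ifP => // _ /eqP h e; rewrite -e in h. Qed.

Lemma image_links_sym J : symmetric_links J -> symmetric_links (image_links J).
Proof.
move=> Js l; apply/existsP/existsP => -[l0 /andP[h /eqP e]];
  exists (swap l0); rewrite Js h /= /collapse2 /=; first by rewrite -[l]swapK -e.
by rewrite -e.
Qed.

Lemma image_linksS J J' : subpred J J' -> subpred (image_links J) (image_links J').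
Proof.
move=> sJ l /existsP[l0 /andP[h e]]; apply/existsP; exists l0.
by rewrite e sJ.
Qed.

Lemma map_collapse_links p cs q : {in cs, forall v, v \notin S} ->
  map collapse2 (links f p cs q) = links f (collapse p) cs (collapse q).
Proof.
elim: cs p => //= c cs IH p h; rewrite IH => [|v vcs]; last by rewrite h // inE vcs orbT.
by rewrite /collapse2 /= !(collapse_notin (v := c)) ?(collapse_notin (v := f c)) ?fS
   ?h ?mem_head.
Qed.

(** [collapse] is ambiguous only over [x], and on a path not ending at [x] this vertex can occur
    only as the start. So all vertices but the first lift to themselves. *)
Lemma lift_links p cs q ls : map collapse2 ls = links f p cs q ->
  q != x -> {in cs, forall v, v \notin S} -> x \notin cs ->
  exists2 p0, collapse p0 = p & ls = links f p0 cs q.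
Proof.
elim: cs p ls => [|c cs IH] p [|l ls] //= [].
  case: l ls => a b [] //= e1 e2 _ qx _ _; exists a => //.
  by rewrite (collapse_neq qx e2).
case: l => a b /= e1 e2 e qx h; rewrite inE negb_or eq_sym => /andP[cx xcs].
have [|p0 e3 ->] := IH _ _ e qx _ xcs.
  by move=> v vcs; rewrite h // inE vcs orbT.
have -> : p0 = f c.
  by apply: (collapse_neq _ e3); apply: contra cx => /eqP h'; rewrite -[c]fK h' fx.
by exists a => //; rewrite (collapse_neq cx e2).
Qed.

Lemma all_image_lift J ls : all (image_links J) ls ->
  exists2 ls0, map collapse2 ls0 = ls & all J ls0.
Proof.
elim: ls => [|l ls IH] /=; first by exists [::].
case/andP=> /existsP[l0 /andP[h /eqP e]] /IH[ls0 h1 h2].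
by exists (l0 :: ls0); rewrite /= ?e ?h1 ?h ?h2.
Qed.

(** The property of a blossom that lifting needs: each [w] in [S] is the end of an even alternating
    path from [x] that stays in [S], so a link leaving [S] at [w] can be used as if it left [x]. *)
Definition blob J := {in S, forall w, exists zs,
  [/\ valid f (rcons zs (f w)), {in rcons zs (f w), forall v, v \in S} &
      all J (links f x zs (f w))]}.

Lemma lift_path J p cs q : blob J -> freeze f S p = p -> q != x ->
    valid (freeze f S) cs -> all (image_links J) (links (freeze f S) p cs q) ->
  exists cs0, [/\ f p = p, valid f cs0, {in cs0, forall v, v \in S} &
    all J (links f p (cs0 ++ cs) q)].
Proof.
move=> bJ hp qx /(valid_freezeP fK fS)[hv hS]; rewrite links_freeze //.
case/all_image_lift=> ls0 e hJ.
have [|p0 e1 e2] := lift_links e qx hS; first exact: valid_notin hv _.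
have pS : p \notin S by rewrite -e1 collapse_out.
have fp : f p = p by case: (freeze_fixP hp) => // pS'; rewrite pS' in pS.
rewrite e2 in hJ; case: (boolP (p0 \in S)) => p0S; last first.
  by exists [::]; split=> //; move: e1; rewrite collapse_notin // => <-.
have [zs [vz zS zJ]] := bJ _ p0S; exists (rcons zs (f p0)); split=> //.
rewrite -e1 /collapse p0S cat_rcons links_cat all_cat zJ /=.
by rewrite fK.
Qed.

Lemma valid_lift cs0 cs : valid f cs0 -> {in cs0, forall v, v \in S} ->
  valid f cs -> {in cs, forall v, v \notin S} -> valid f (cs0 ++ cs).
Proof.
move=> v0 h0 v1 h1; rewrite valid_cat // v0 v1 /=; apply/hasPn => v vcs0.
rewrite /touch negb_or; apply/andP; split; apply/negP => /h1.
  by rewrite h0.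
by rewrite fS h0.
Qed.

Lemma augmentable_contract J : symmetric_links J -> blob J ->
  augmentable (freeze f S) (image_links J) -> augmentable f J.
Proof.
move=> Js bJ [p [cs [q [hp hq pq hv hJ]]]].
have frK := freezeK fK fS.
(* At most one end is [x]; after a reversal it is the start, where a path through the blob can be
   inserted. *)
wlog qx : p q cs hp hq pq hv hJ / q != x.
  move=> wl; have [qx|] := eqVneq q x; last by move=> h; apply: (wl p q cs).
  apply: (wl q p (rev (map (freeze f S) cs))) => //; first by rewrite eq_sym.
  - by rewrite valid_flip.
  - by rewrite all_links_rev //; apply: image_links_sym.
  - by rewrite -qx.
have [cs0 [fp v0 h0 h]] := lift_path bJ hp qx hv hJ.
have [hv1 hv2] : valid f cs /\ {in cs, forall v, v \notin S} by apply/valid_freezeP.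
exists p, (cs0 ++ cs), q; split=> //; last exact: valid_lift.
case: (freeze_fixP hq) => // qS.
have /(allP hJ)/existsP[l0 /andP[_ /eqP]] := links_last_mem (freeze f S) p cs q.
by case=> _ e; rewrite -e (negPf (collapse_out _)) in qS.
Qed.

Lemma reachable_contract J v : blob J ->
  reachable (freeze f S) (image_links J) v -> reachable f J v.
Proof.
move=> bJ [p [cs [hp /(valid_freezeP fK fS)[hv hS] hJ]]].
have vS : v \notin S.
  apply/negP => vS; have := hS (freeze f S v).
  by rewrite mem_rcons mem_head /freeze vS => /(_ isT); rewrite vS.
rewrite (freeze_notin _ vS) in hv hS hJ.
have hcs : {in cs, forall v, v \notin S} by move=> w h; rewrite hS // mem_rcons inE h orbT.
have vcs : valid f cs by move: hv; rewrite -cats1 valid_cat // => /and3P[].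
have fvx : f v != x.
  by have := valid_notin fK hv fx; rewrite mem_rcons inE negb_or eq_sym => /andP[].
have [|cs0 [fp v0 h0 h]] := lift_path bJ hp fvx _ hJ; first exact/valid_freezeP.
by exists p, (cs0 ++ cs); split=> //; rewrite rcons_cat; apply: valid_lift.
Qed.

Lemma last_in cs : has (mem S) cs -> exists (l1 : seq V) c (l2 : seq V),
  [/\ cs = l1 ++ c :: l2, c \in S & {in l2, forall v, v \notin S}].
Proof.
elim: cs => //= d cs IH; case: (boolP (has (mem S) cs)) => [/IH|/hasPn h].
  by move=> [l1 [c [l2 [-> h1 h2]]]] _; exists (d :: l1), c, l2.
by rewrite orbF => dS; exists [::], d, cs.
Qed.

Lemma first_in cs : has (mem S) cs -> exists (l1 : seq V) c (l2 : seq V),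
  [/\ cs = l1 ++ c :: l2, c \in S & {in l1, forall v, v \notin S}].
Proof.
elim: cs => //= d cs IH; case: (boolP (d \in S)) => [dS _|dS /= /IH].
  by exists [::], d, cs.
move=> [l1 [c [l2 [-> h1 h2]]]]; exists (d :: l1), c, l2; split=> //.
by move=> v; rewrite inE => /orP[/eqP->|/h2].
Qed.

Lemma all_image_links J p cs q : {in cs, forall v, v \notin S} ->
  all J (links f p cs q) ->
  all (image_links J) (links (freeze f S) (collapse p) cs (collapse q)).
Proof.
move=> h hJ; rewrite links_freeze // -map_collapse_links // all_map.
apply: sub_all hJ => l Jl; apply/existsP; exists l; by rewrite Jl eqxx.
Qed.

Lemma reachable_contract_inv J v : v \notin S ->
  reachable f J v -> reachable (freeze f S) (image_links J) v.
Proof.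
move=> vS [p [cs [fp hv hJ]]].
have fvS : f v \notin S by rewrite fS.
have key a s : f (collapse a) = collapse a -> valid f (rcons s (f v)) ->
    {in s, forall w, w \notin S} ->
    all J (links f a s (f v)) -> reachable (freeze f S) (image_links J) v.
  move=> fa vs sS /(all_image_links sS); rewrite (collapse_notin fvS) => h.
  exists (collapse a), s; rewrite !(freeze_notin f vS) (freeze_notin f (collapse_out _)).
  split=> //; apply/valid_freezeP => //; split=> // w.
  by rewrite mem_rcons inE => /orP[/eqP->|/sS].
case: (boolP (has (mem S) cs)) => [/last_in[l1 [c [l2 [e cS h]]]]|/hasPn h].
  move: hv hJ; rewrite e links_cat all_cat rcons_cat rcons_cons valid_cat //.
  case/and3P=> _; rewrite valid_cons // => /and3P[_ _ hv] _ /andP[_].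
  by apply: key => //; rewrite /collapse fS cS.
by apply: key hJ => //; rewrite collapse_notin // root_notin.
Qed.

(** A path meeting [S] is cut there and the cut end collapses to [x]. The piece kept is the one
    whose other end differs from [x]: the initial piece if [p] does, otherwise the final one. *)
Lemma contract_dipath p cs q : f p = p -> f q = q -> p != q -> valid f cs ->
  exists p' cs' q', [/\ freeze f S p' = p', freeze f S q' = q', p' != q',
    valid (freeze f S) cs' &
    all (image_links [pred l in links f p cs q]) (links (freeze f S) p' cs' q')].
Proof.
move=> fp fq pq hv; have pS := root_notin fp; have qS := root_notin fq.
have fr v : v \notin S -> f v = v -> freeze f S v = v by move=> h fv; rewrite freeze_notin.
have aJ : all [pred l in links f p cs q] (links f p cs q) by apply/allP.
case: (boolP (has (mem S) cs)) => [hS|/hasPn h]; last first.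
  exists p, cs, q; split=> //; try exact: fr; first exact/valid_freezeP.
  by rewrite -{2}(collapse_notin pS) -{2}(collapse_notin qS); apply: all_image_links.
have [px|px] := eqVneq p x; last first.
  have [l1 [c [l2 [e cS h]]]] := first_in hS; exists p, l1, x; split=> //; try exact: fr.
    apply/valid_freezeP => //; split=> //.
    by move: hv; rewrite e valid_cat // => /and3P[].
  have <- : collapse c = x by rewrite /collapse cS.
  rewrite -{2}(collapse_notin pS); apply: all_image_links => //.
  by move: aJ; rewrite {2}e links_cat all_cat => /andP[].
have [l1 [c [l2 [e cS h]]]] := last_in hS; exists x, l2, q; split=> //; try exact: fr.
- by rewrite -px.
- apply/valid_freezeP => //; split=> //.
  by move: hv; rewrite e valid_cat // => /and3P[_]; rewrite valid_cons // => /and3P[].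
have <- : collapse (f c) = x by rewrite /collapse fS cS.
rewrite -{2}(collapse_notin qS); apply: all_image_links => //.
by move: aJ; rewrite {2}e links_cat all_cat => /andP[].
Qed.

End Contract.

Definition link_of f p cs q : pred (V * V) :=
  [pred l | (l \in links f p cs q) || (swap l \in links f p cs q)].

Lemma link_of_rev f p cs q : involutive f ->
  link_of f q (rev (map f cs)) p =1 link_of f p cs q.
Proof.
move=> fK l; rewrite /link_of !inE links_rev // !mem_rev.
have e l' : (l' \in map swap (links f p cs q)) = (swap l' \in links f p cs q).
  by rewrite -{1}[l']swapK (mem_map (inv_inj swapK)).
by rewrite !e swapK orbC.
Qed.

(** * Restriction of a path after the deletion of a matching edge *)

Section Pair.
Variables (f : V -> V) (fK : involutive f) (c : V).
Hypothesis (fc : f c != c).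
Let S : {set V} := [set c; f c].

Lemma pair_closed v : (f v \in S) = (v \in S).
Proof.
rewrite !inE (inj_eq (inv_inj fK)) orbC; congr orb.
by apply/eqP/eqP => [<-|->]; rewrite fK.
Qed.

Lemma pair_active : {in S, forall v, f v != v}.
Proof. by move=> v; rewrite !inE => /orP[]/eqP-> //; rewrite fK eq_sym. Qed.

Lemma notin_pair v : (v \notin S) = (v != c) && (v != f c).
Proof. by rewrite !inE negb_or. Qed.

Lemma touch_pairPn cs : reflect {in cs, forall v, v \notin S} (~~ touch f cs c).
Proof.
rewrite /touch negb_or; apply: (iffP andP) => [[n1 n2] v vs|h].
  by rewrite notin_pair; apply/andP; split;
     [apply: contra n1|apply: contra n2] => /eqP<-.
by split; apply/negP => /h; rewrite !inE eqxx ?orbT.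
Qed.

Lemma avoid_links J a s b : f b = b -> a != c -> {in s, forall v, v \notin S} ->
  all J (links f a s b) -> all (avoid c J) (links (freeze f S) a s b).
Proof.
move=> fb ac sS aL; rewrite links_freeze //; apply/allP => l hl.
rewrite /avoid inE (allP aL) //=; have [h1 h2] := linksP hl.
apply/andP; split.
  move: h1; rewrite inE => /orP[/eqP->//|]; rewrite mem_map_inv // => /sS.
  by rewrite pair_closed; apply: contra => /eqP->; rewrite !inE eqxx.
move: h2; rewrite mem_rcons inE => /orP[/eqP->|/sS].
  by apply: contra fc => /eqP<-; rewrite fb.
by apply: contra => /eqP->; rewrite !inE eqxx.
Qed.

(** If the path runs through the edge [c], [f c], orient it so that it enters at [c]; the part after
    this edge starts at the new root [f c]. *)
Lemma delete_dipath p cs q :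
    f p = p -> f q = q -> p != q -> valid f cs ->
  exists p' cs' q', [/\ freeze f S p' = p', freeze f S q' = q', p' != q',
    valid (freeze f S) cs' &
    all (avoid c (link_of f p cs q)) (links (freeze f S) p' cs' q')].
Proof.
move=> fp fq pq hv.
have rootS := root_notin pair_active.
have fr v : f v = v -> freeze f S v = v by move=> fv; rewrite freeze_notin ?rootS.
have neq v : f v = v -> (v != c) && (f c != v).
  by move=> fv; have := rootS v fv; rewrite notin_pair (eq_sym _ (f c)).
wlog hc : p cs q fp fq pq hv / touch f cs c -> c \in cs.
  move=> wl; case: (boolP (f c \in cs)) => h; last first.
    by apply: wl => // /orP[]//; rewrite (negPf h).
  have [|||p' [cs' [q' [h1 h2 h3 h4 h5]]]] := wl q (rev (map f cs)) p fq fp.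
  - by rewrite eq_sym.
  - by rewrite valid_flip.
  - by move=> _; rewrite mem_rev mem_map_inv.
  exists p', cs', q'; split=> //; apply: sub_all h5 => l.
  by rewrite /avoid !inE link_of_rev.
case: (boolP (touch f cs c)) => [/hc ccs|].
  case/splitPr e: _ / ccs hv => [s1 s2] hv; exists (f c), s2, q.
  move: hv; rewrite valid_cat // valid_cons // => /and3P[_ /and3P[_ hc2 hv] _].
  move/touch_pairPn in hc2.
  split.
  - by rewrite /freeze !inE eqxx orbT.
  - exact: fr.
  - by have /andP[] := neq q fq.
  - by apply/(valid_freezeP fK pair_closed).
  - apply: avoid_links => //; apply/allP => l hl; rewrite /link_of inE links_cat mem_cat.
    by rewrite hl !orbT.
move/touch_pairPn => sS; exists p, cs, q.
split; try exact: fr; try done; first by apply/(valid_freezeP fK pair_closed).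
apply: avoid_links => //; first by have /andP[] := neq p fp.
by apply/allP => l hl; rewrite /link_of inE hl.
Qed.

End Pair.

Lemma add_link_self J l : add_link J l l.
Proof. by apply/or3P; constructor 2. Qed.

Lemma avoid_add_link c J l : l.1 != c -> l.2 != c ->
  subpred (add_link (avoid c J) l) (avoid c (add_link J l)).
Proof.
move=> h1 h2 l' /or3P[/and3P[h3 h4 h5]|/eqP->|/eqP e].
- by apply/and3P; split=> //; apply/orP; left.
- by apply/and3P; split=> //; apply/or3P; constructor 2.
- rewrite -e in h1 h2; apply/and3P; split=> //.
  by apply/or3P; constructor 3; rewrite e.
Qed.

Lemma image_add_link x S J l :
  subpred (add_link (image_links x S J) (collapse2 x S l))
          (image_links x S (add_link J l)).
Proof.
have self : image_links x S (add_link J l) (collapse2 x S l).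
  by apply/existsP; exists l; rewrite add_link_self eqxx.
move=> l' /or3P[|/eqP->//|/eqP e]; first by move=> h;
  exact: (image_linksS (@sub_add_link J l) h).
apply/existsP; exists (swap l); apply/andP; split.
  by apply/or3P; constructor 3; rewrite swapK.
by rewrite -[l']swapK e.
Qed.

Lemma avoid_sym c J : symmetric_links J -> symmetric_links (avoid c J).
Proof. by move=> Js l; rewrite /avoid !inE Js /= (andbC (l.2 != c)). Qed.

(* An even alternating path to [c] closes up to an odd cycle through the root
   [x], which can be run through in both directions. *)
Lemma cycle_blob f J x s : involutive f -> symmetric_links J -> f x = x ->
    valid f s -> all J (links f x s x) ->
  blob f x [set v | touch f s v] J.
Proof.
move=> fK Js fx hv hJ w; rewrite inE.
have key t u : valid f t -> all J (links f x t x) -> (forall v, v \in t -> touch f s v) ->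
    f u \in t -> exists zs, [/\ valid f (rcons zs (f u)),
      {in rcons zs (f u), forall v, v \in [set v | touch f s v]} &
      all J (links f x zs (f u))].
  move=> vt aJ ts ut; case/splitPr: ut vt aJ ts => t1 t2.
  rewrite -cat_rcons valid_cat // => /and3P[vt _ _].
  rewrite cat_rcons links_cat all_cat => /andP[aJ _] ts.
  exists t1; split=> // v h; rewrite inE; apply: ts.
  by rewrite -cat_rcons mem_cat h.
case/orP=> h; last first.
  by apply: (key s) => // v vs; rewrite /touch vs.
apply: (key (rev (map f s))) => //; first by rewrite valid_flip.
- by rewrite all_links_rev.
- by move=> v; rewrite mem_rev mem_map_inv // /touch => ->; rewrite orbT.
- by rewrite mem_rev mem_map_inv // fK.
Qed.

Theorem growth f J p cs q : involutive f -> symmetric_links J ->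
    f p = p -> f q = q -> p != q -> valid f cs -> ~ augmentable f J ->
  exists2 l, link_of f p cs q l &
    augmentable f (add_link J l) \/
    exists2 v, reachable f (add_link J l) v & ~ reachable f J v.
Proof.
move: {2}_.+1 (ltnSn #|[pred v | f v != v]|) => N.
elim: N f J p cs q => // N IH f J p cs q leN fK Js fp fq pq hv nA.
case: (classic (exists x c, [/\ f x = x, f c != c & J (x, c)])); last first.
  (* Without a link from a root to a covered vertex nothing is reachable, so the first link of the
     given path suffices: either it joins two roots, or it makes [f c] reachable. *)
  move=> noroot; case: cs hv => [|c s] hv.
    exists (p, q); first by rewrite /link_of !inE eqxx.
    left; exists p, [::], q; split=> //.
    by rewrite /= andbT; exact: add_link_self.
  have fc : f c != c by move: hv; rewrite valid_cons // => /and3P[].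
  exists (p, c); first by rewrite /link_of !inE eqxx.
  right; exists (f c).
    exists p, [::]; split=> //; first by rewrite fK /= valid_cons //= fc.
    by rewrite fK /= andbT; exact: add_link_self.
  case=> [p0 [s0 [h1 h2 h3]]]; apply: noroot.
  case: s0 h2 h3 => [|d s0] h2 /= /andP[h3 _]; first by exists p0, c; split=> //; rewrite -(fK c).
  by exists p0, d; split=> //; move: h2; rewrite /= valid_cons // => /and3P[].
case=> [x [c [fx fc Jxc]]].
case: (classic (reachable f J c)) => [rc|nrc]; last first.
  set S : {set V} := [set c; f c].
  have fS := pair_closed fK c; have Sact := pair_active fK fc.
  have [p' [cs' [q' [hp' hq' pq' hv' hJ']]]] := delete_dipath fK fc fp fq pq hv.
  have nA' : ~ augmentable (freeze f S) (avoid c J).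
    by case/(augmentable_delete fK fx fc Js Jxc).
  have [|l hl hgrow] := IH (freeze f S) (avoid c J) p' cs' q' _ (freezeK fK fS)
    (avoid_sym c Js) hp' hq' pq' hv' nA'.
    rewrite -ltnS (leq_trans _ leN) // ltnS (card_active_freeze Sact).
    by rewrite -addn1 leq_add2l cards2.
  have {}hJ' l' : link_of (freeze f S) p' cs' q' l' ->
      [/\ link_of f p cs q l', l'.1 != c & l'.2 != c].
    by case/orP=> /(allP hJ')/and3P[] //; rewrite /link_of !inE swapK orbC.
  have [h1 h2 h3] := hJ' l hl; exists l => //.
  have Js' := add_link_sym l Js.
  have J'xc : add_link J l (x, c) by exact: sub_add_link.
  (* An augmenting path of the reduced instance that does not lift to one for [f] shows that [c] has
     become reachable; in that case [c] is the new vertex. *)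
  case: hgrow => [hA|[v rv nv]].
    have := augmentable_sub (avoid_add_link h2 h3) hA.
    by case/(augmentable_delete fK fx fc Js' J'xc) => h; [left|right; exists c].
  have := reachable_sub (avoid_add_link h2 h3) rv => rv'.
  right; exists v; first exact: (reachable_delete fK fx fc J'xc rv').
  move=> rv0; apply: nv; apply: reachable_delete_inv => //.
  case: rv => [a [s [_ /valid_freezeP]]] -/(_ fK fS)[_ h] _.
  apply/negP => vS; have := h (freeze f S v); rewrite mem_rcons mem_head.
  by rewrite /freeze vS => /(_ isT); rewrite vS.
case: rc => [y [s [fy vs aJ]]].
(* An even path to [c] from another root would be augmenting together with the link from [c] to [x].
   So it starts at [x], and this link closes it to an odd cycle. *)
have xy : y = x.
  apply/eqP/negPn/negP => yx; apply: nA; exists y, (rcons s (f c)), x; split=> //.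
  by rewrite links_rcons all_rcons aJ fK andbT -[(c, x)]/(swap (x, c)) Js.
rewrite xy in aJ.
have {aJ} : all J (links f x (rcons s (f c)) x).
  by rewrite links_rcons all_rcons aJ fK andbT -[(c, x)]/(swap (x, c)) Js.
have ct : f c \in rcons s (f c) by rewrite mem_rcons mem_head.
move: (rcons s (f c)) vs ct => t vt ct aJ.
set S : {set V} := [set v | touch f t v].
have fS v : (f v \in S) = (v \in S) by rewrite !inE touchf.
have Sact : {in S, forall v, f v != v}.
  by move=> v; rewrite inE; apply: valid_active.
have bJ := cycle_blob fK Js fx vt aJ.
have [p' [cs' [q' [hp' hq' pq' hv' hJ']]]] := contract_dipath fK fx fS Sact fp fq pq hv.
have nA' : ~ augmentable (freeze f S) (image_links x S J).
  by move/(augmentable_contract fK fx fS Sact Js bJ).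
have [|l hl hgrow] := IH (freeze f S) (image_links x S J) p' cs' q' _ (freezeK fK fS)
    (image_links_sym x S Js) hp' hq' pq' hv' nA'.
  rewrite -ltnS (leq_trans _ leN) // ltnS (card_active_freeze Sact).
  rewrite -addn1 leq_add2l card_gt0; apply/set0Pn; exists (f c).
  by rewrite inE /touch ct.
have [l0 hl0 el] : exists2 l0, link_of f p cs q l0 & collapse2 x S l0 = l.
  case/orP: hl => /(allP hJ')/existsP[l0 /andP[h /eqP e]].
    by exists l0; rewrite // /link_of inE; apply/orP; left.
  exists (swap l0); first by rewrite /link_of inE swapK; apply/orP; right.
  by rewrite -[l]swapK -e.
have Js' := add_link_sym l0 Js; rewrite -el in hgrow.
have bJ' : blob f x S (add_link J l0).
  move=> w /bJ[zs [h1 h2 h3]]; exists zs; split=> //.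
  by apply: sub_all h3; apply: sub_add_link.
exists l0 => //; case: hgrow => [hA|[v rv nv]]; [left|right].
  have := augmentable_sub (@image_add_link x S J l0) hA.
  exact: augmentable_contract.
exists v; first exact: reachable_contract (reachable_sub (@image_add_link x S J l0) rv).
move=> rv0; apply: nv; apply: reachable_contract_inv => //.
case: rv => [a [s' [_ /valid_freezeP]]] -/(_ fK fS)[_ h] _.
apply/negP => vS; have := h (freeze f S v); rewrite mem_rcons mem_head.
by rewrite /freeze vS => /(_ isT); rewrite vS.
Qed.

End Growth.
End Dipaths.

(** * Rainbow paths *)

Section Colours.
Variables (V I : finType).
Implicit Types (f : V -> V) (D : V * seq V * V) (C M : {set I}) (Q : I -> V * seq V * V).
Implicit Types (ls : seq (V * V)).

Definition dlinks f D := links f D.1.1 D.1.2 D.2.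
Definition has_link f D := link_of f D.1.1 D.1.2 D.2.
Definition aap f D := [&& f D.1.1 == D.1.1, f D.2 == D.2, D.1.1 != D.2 & valid f D.1.2].

Definition colourable f Q C ls : Prop := exists s : seq I,
  [/\ uniq s, {subset s <= C} & all2 (fun i l => has_link f (Q i) l) s ls].

Definition rainbow_free f Q C :=
  forall D, aap f D -> ~ colourable f Q C (dlinks f D).

Lemma has_linkC f D l : has_link f D (swap l) = has_link f D l.
Proof. by rewrite /has_link /link_of !inE swapK orbC. Qed.

Lemma colourable_sub f Q C C' ls :
  C \subset C' -> colourable f Q C ls -> colourable f Q C' ls.
Proof.
by move=> /subsetP sC [s [h1 h2 h3]]; exists s; split=> // i /h2/sC.
Qed.

Lemma colourable1 f Q C i l : i \in C -> has_link f (Q i) l -> colourable f Q C [:: l].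
Proof.
move=> iC h; exists [:: i]; split=> //=; last by rewrite h.
by move=> j; rewrite inE => /eqP->.
Qed.

Lemma colourable_cat f Q C1 C2 ls1 ls2 : [disjoint C1 & C2] ->
  colourable f Q C1 ls1 -> colourable f Q C2 ls2 ->
  colourable f Q (C1 :|: C2) (ls1 ++ ls2).
Proof.
move=> dC [s1 [u1 c1 a1]] [s2 [u2 c2 a2]]; exists (s1 ++ s2); split.
- rewrite cat_uniq u1 u2 andbT /=; apply/hasPn => i /c2 i2; apply/negP => /c1 i1.
  by move/disjointFr: dC => /(_ i i1); rewrite i2.
- by move=> i; rewrite mem_cat inE => /orP[/c1->|/c2->]; rewrite ?orbT.
- by move: a1 a2; rewrite !all2E !size_cat => /andP[/eqP e1 h1] /andP[/eqP e2 h2];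
     rewrite zip_cat // all_cat h1 h2 e1 e2 eqxx.
Qed.

Lemma colourable_cons f Q C i l ls : i \in C -> has_link f (Q i) l ->
  colourable f Q (C :\ i) ls -> colourable f Q C (l :: ls).
Proof.
move=> iC h hls; rewrite -(setD1K iC) -[l :: ls]cat1s; apply: colourable_cat => //.
  by rewrite disjoints1 !inE eqxx.
by apply: colourable1 h; rewrite inE.
Qed.

Lemma colourable_rcons f Q C i l ls : i \in C -> has_link f (Q i) l ->
  colourable f Q (C :\ i) ls -> colourable f Q C (rcons ls l).
Proof.
move=> iC h hls; rewrite -(setD1K iC) setUC -cats1; apply: colourable_cat => //.
  by rewrite disjoint_sym disjoints1 !inE eqxx.
by apply: colourable1 h; rewrite inE.
Qed.

(** Members that share a stretch of path colour it in any order, provided there are enough of them.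
    The multiplicities of a badge are used in this way. *)
Lemma colourable_all f Q M ls : (forall i, i \in M -> all (has_link f (Q i)) ls) ->
  size ls <= #|M| -> colourable f Q M ls.
Proof.
move=> h hs; exists (take (size ls) (enum M)).
have hsub i : i \in take (size ls) (enum M) -> i \in M.
  by move/mem_take; rewrite mem_enum.
split=> //; first by rewrite take_uniq ?enum_uniq.
have : size (take (size ls) (enum M)) = size ls.
  by rewrite size_takel // -cardE.
elim: ls {hs} h (take _ _) hsub => [|l ls IH] h [|i s] //= hsub [hs].
have /andP[-> _] := h i (hsub i (mem_head _ _)).
apply: IH => // [j /h /andP[] //|j js]; by apply: hsub; rewrite inE js orbT.
Qed.

(** * Partial colourings and the counting bound *)

Section Colouring.
Variables (f : V -> V) (Q : I -> V * seq V * V) (C : {set I}).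
Implicit Types (K : seq (I * (V * V))).

Definition colouring K :=
  uniq (unzip1 K) && all (fun e => (e.1 \in C) && has_link f (Q e.1) e.2) K.

Definition colours K i l := has (fun e => (e.1 == i) && ((e.2 == l) || (swap e.2 == l))) K.

Definition coloured K : pred (V * V) := [pred l | has (fun e => (e.2 == l) || (swap e.2 == l)) K].

Lemma colouredP K l : reflect (exists i, colours K i l) (coloured K l).
Proof.
apply: (iffP hasP) => [[e eK h]|[i /hasP[e eK /andP[_ h]]]]; last by exists e.
by exists e.1; apply/hasP; exists e; rewrite ?eqxx.
Qed.

Lemma swap_eq (l l' : V * V) : (swap l == l') = (l == swap l').
Proof. by rewrite -{2}(swapK l) (inj_eq (inv_inj (@swapK V))). Qed.

Lemma coloured_sym K : symmetric_links (coloured K).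
Proof.
move=> l; rewrite /coloured !inE; apply: eq_has => e.
by rewrite swap_eq swapK orbC swap_eq.
Qed.

Lemma colours_fun K i l l' : uniq (unzip1 K) ->
  colours K i l -> colours K i l' -> l' = l \/ l' = swap l.
Proof.
move=> uK /hasP[[i1 e] eK /andP[/eqP/= e1 h]] /hasP[[i2 e'] eK' /andP[/eqP/= e2 h']].
have E : e = e'.
  elim: (K) uK eK eK' => // -[j d] K' IH /= /andP[jK uK]; rewrite !inE.
  case/orP=> [/eqP[h1 h2]|m] /orP[/eqP[h1' h2']|m'].
  - by rewrite h2 h2'.
  - by case/negP: jK; rewrite -h1 e1 -e2; apply: (map_f fst m').
  - by case/negP: jK; rewrite -h1' e2 -e1; apply: (map_f fst m).
  - exact: IH.
rewrite -E in h'; move: h h'; rewrite !swap_eq.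
move=> /orP[]/eqP-> /orP[]/eqP h; [left|right|right|left] => //.
- by rewrite h swapK.
- by rewrite -[l']swapK -h swapK.
Qed.

Lemma colours_sound K i l : colouring K -> colours K i l ->
  i \in C /\ has_link f (Q i) l.
Proof.
case/andP=> _ /allP aK /hasP[[i' e] /aK/andP[/= h1 h2] /andP[/eqP/= <- h]].
by split=> //; case/orP: h => /eqP <-; rewrite ?has_linkC.
Qed.

(** A colour determines its link up to direction, and on a path no link recurs in either direction,
    because no vertex occurs twice among the ends of links. Hence the colours found are distinct. *)
Lemma colouring_colourable K ls : colouring K -> all (coloured K) ls ->
  uniq (map fst ls ++ map snd ls) -> colourable f Q C ls.
Proof.
move=> hK aK uls; have /andP[uK _] := hK.
suff [s [us hs]] : exists s, uniq s /\ all2 (colours K) s ls.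
  exists s; split=> //.
  - elim: s (ls) hs {us} => [|i s IH] [|l ls'] //= /andP[h /IH hs] j.
    by rewrite inE => /orP[/eqP->|/hs//]; case: (colours_sound hK h).
  - elim: s (ls) hs {us} => [|i s IH] [|l ls'] //= /andP[h /IH ->].
    by case: (colours_sound hK h) => _ ->.
elim: ls aK uls => [|l ls IH] /=; first by exists [::].
case/andP=> /colouredP[i il] /IH hIH /andP[n1 u].
have [|s [us hs]] := hIH.
  by move: u; rewrite -cat1s uniq_catCA /= => /andP[].
exists (i :: s); rewrite /= us il hs andbT; split=> //; apply/negP => si.
have [l' l'ls il'] : exists2 l', l' \in ls & colours K i l'.
  elim: s (ls) hs si {us} => [|j s IHs] [|l' ls'] //= /andP[h hs].
  rewrite inE => /orP[/eqP->|/(IHs _ hs)[l0 h1 h2]].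
    by exists l'; rewrite ?mem_head.
  by exists l0; rewrite // inE h1 orbT.
move: n1; rewrite mem_cat inE !negb_or => /and3P[n1 _ n2].
case: (colours_fun uK il il') => e; rewrite e in l'ls.
  by case/negP: n1; apply: map_f.
by case/negP: n2; apply: (map_f snd l'ls).
Qed.

Hypotheses (fK : involutive f) (aapQ : {in C, forall i, aap f (Q i)}).
Hypothesis free : rainbow_free f Q C.

Lemma coloured_not_augmentable K : colouring K -> ~ augmentable f (coloured K).
Proof.
move=> hK [p [cs [q [fp fq pq hv hJ]]]]; case: (free (D := (p, cs, q))).
  by rewrite /aap /= fp fq !eqxx pq.
exact: (colouring_colourable hK hJ (links_uniq fK hv fp fq pq)).
Qed.

Lemma size_colouring K : colouring K -> size K <= #|C|.
Proof.
case/andP=> uK /allP aK; rewrite -(size_map fst) -(card_uniqP uK); apply: subset_leq_card.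
by apply/subsetP => i /mapP[e /aK/andP[h _] ->].
Qed.

Lemma saturate K (T : {set V}) : colouring K ->
    (forall v, v \in T -> reachable f (coloured K) v) ->
  exists K' (T' : {set V}), [/\ colouring K', size K' = #|C|,
    forall v, v \in T' -> reachable f (coloured K') v &
    #|T| + #|C| <= #|T'| + size K].
Proof.
move e: (#|C| - size K) => n; elim: n K T e => [|n IH] K T e hK rT.
  have sK : size K = #|C|.
    by apply/eqP; rewrite eqn_leq size_colouring // -subn_eq0 e.
  by exists K, T; rewrite sK.
have [i iC iK] : exists2 i, i \in C & i \notin unzip1 K.
  apply/exists_inP; case: (boolP [exists _ in _, _]) => //.
  rewrite negb_exists_in => /forall_inP h.
  have : #|C| <= size K.
    rewrite cardE -(size_map fst); apply: uniq_leq_size; first exact: enum_uniq.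
    by move=> j; rewrite mem_enum => /h; rewrite negbK.
  by rewrite -subn_eq0 e.
have /and4P[/eqP fp /eqP fq pq hv] := aapQ iC.
have [l hl hgrow] := growth fK (coloured_sym K) fp fq pq hv (coloured_not_augmentable hK).
have hK' : colouring ((i, l) :: K).
  by move/andP: hK => [u a]; rewrite /colouring /= iK u iC a [has_link _ _ _]hl.
have sub : subpred (add_link (coloured K) l) (coloured ((i, l) :: K)).
  move=> l' /or3P[h|/eqP->|/eqP <-]; apply/orP; [by right|left|left].
    by rewrite /= eqxx.
  by rewrite /= swapK eqxx orbT.
case: hgrow => [/(augmentable_sub sub)|[v rv nv]].
  by move/(coloured_not_augmentable hK').
have vT : v \notin T by apply/negP => /rT.
have [||K' [T' [h1 h2 h3 h4]]] := IH ((i, l) :: K) (v |: T) _ hK'.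
- by rewrite subnS e.
- move=> w; rewrite !inE => /orP[/eqP->|/rT]; first exact: reachable_sub rv.
  by apply: reachable_sub => l' h; apply: sub; apply: sub_add_link.
exists K', T'; split=> //; move: h4.
by rewrite cardsU1 vT add1n /= addnS addSn ltnS.
Qed.

Lemma reachable_active J v : reachable f J v -> f v != v.
Proof.
case=> p [cs [_ hv _]]; apply: (valid_active fK hv).
by rewrite /touch !mem_rcons !inE eqxx orbT.
Qed.

Lemma count_colouring K (T : {set V}) : colouring K ->
    (forall v, v \in T -> reachable f (coloured K) v) ->
  #|T| + #|C| <= #|[pred v | f v != v]| + size K.
Proof.
move=> hK /(saturate hK)[K' [T' [_ _ h3 h4]]]; apply: leq_trans h4 _.
rewrite leq_add2r subset_leq_card //; apply/subsetP => v /h3.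
exact: reachable_active.
Qed.

Lemma card_colours_le : #|C| <= #|[pred v | f v != v]|.
Proof.
have := @count_colouring [::] set0 isT; rewrite cards0 add0n addn0; apply=> v.
by rewrite inE.
Qed.

(** One pair of [K] for each link is kept. The bound on the number of colours is what [triangle]
    compares with the number of vertices on the cycle. *)
Lemma sub_colouring K ls : colouring K -> all (coloured K) ls ->
  exists K0, [/\ colouring K0, {subset K0 <= K}, size K0 <= size ls & all (coloured K0) ls].
Proof.
move=> hK aK.
suff [K0 [u0 s0 z0 a0]] : exists K0,
    [/\ uniq K0, {subset K0 <= K}, size K0 <= size ls & all (coloured K0) ls].
  exists K0; split=> //; move/andP: hK => [uK /allP aK'].
  apply/andP; split; last by apply/allP => e /s0/aK'.
  rewrite map_inj_in_uniq // => -[i e] [j e'] /s0 h /s0 h' /= ij.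
  elim: (K) uK h h' => // -[k d] K1 IH /= /andP[kK uK]; rewrite !inE.
  case/orP=> [/eqP[h1 h2]|m] /orP[/eqP[h1' h2']|m'].
  - by rewrite ij h2 h2'.
  - by case/negP: kK; rewrite -h1 ij; apply: (map_f fst m').
  - by case/negP: kK; rewrite -h1' -ij; apply: (map_f fst m).
  - exact: IH.
elim: ls aK => [|l ls IH] /=; first by exists [::].
case/andP=> /hasP[e eK h] /IH[K0 [u0 s0 z0 a0]].
case: (boolP (e \in K0)) => eK0.
  exists K0; rewrite u0 a0 andbT; split=> //; first exact: leqW.
  by apply/hasP; exists e.
exists (e :: K0); split; rewrite /= ?eK0 //.
- by move=> e'; rewrite inE => /orP[/eqP->|/s0].
- apply/andP; split; first by apply/orP; left.
  by apply: sub_all a0 => l' h'; apply/orP; right.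
Qed.

(* Saturation reaches every active vertex; hence some root [x] lies on a
   rainbow odd cycle. With [n] nodes it costs [n.+1] colours and makes [2 * n]
   vertices reachable, so the counting bound forces [n = 1]. *)
Lemma triangle : #|C| = #|[pred v | f v != v]| -> 0 < #|C| ->
  exists x a i j, [/\ f x = x, f a != a, i \in C, j \in C & i != j]
    /\ has_link f (Q i) (x, a) /\ has_link f (Q j) (x, f a).
Proof.
move=> eC C0.
have [v|K [T [hK sK rT cT]]] := @saturate [::] set0 isT; first by rewrite inE.
rewrite cards0 add0n addn0 eC in cT.
have eT : T = [set v | f v != v].
  apply/eqP; rewrite eqEcard cardsE cT andbT.
  by apply/subsetP => w /rT/reachable_active; rewrite inE.
have allr v : f v != v -> reachable f (coloured K) v.
  by move=> fv; apply: rT; rewrite eT inE.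
have nA := coloured_not_augmentable hK.
have [v fv] : exists v, f v != v.
  by move: C0; rewrite eC => /card_gt0P[v]; exists v.
have [x [c [fx fc xc]]] : exists x c, [/\ f x = x, f c != c & coloured K (x, c)].
  have [p [cs [fp hv hJ]]] := allr v fv; exists p.
  case: cs hv hJ => [|d s] /=.
    by move=> _ /andP[h _]; exists (f v); rewrite fK eq_sym.
  by rewrite valid_cons // => /and3P[fd _ _] /andP[h _]; exists d.
have [y [s [fy hv hJ]]] := allr c fc.
have cJ : all (coloured K) (links f y (rcons s (f c)) x).
  by rewrite links_rcons all_rcons fK hJ andbT -[(c, x)]/(swap (x, c)) coloured_sym.
have yx : y = x.
  apply/eqP/negPn/negP => yx; apply: nA; by exists y, (rcons s (f c)), x.
rewrite yx in cJ hJ.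
have [K0 [hK0 sK0 z0 a0]] := sub_colouring hK cJ.
have bl := cycle_blob fK (coloured_sym K0) fx hv a0.
set S : {set V} := [set v | touch f (rcons s (f c)) v] in bl.
have rS w : w \in S -> reachable f (coloured K0) w.
  by move=> /bl[zs [h1 h2 h3]]; exists x, zs.
have := count_colouring hK0 rS; rewrite eC addnC leq_add2l => cS.
have cS2 : #|S| = size (rcons s (f c) ++ map f (rcons s (f c))).
  rewrite -(card_uniqP hv); apply: eq_card => w.
  by rewrite inE mem_cat mem_map_inv.
have s0 : s = [::].
  have := leq_trans cS z0; rewrite cS2 size_links size_cat size_map size_rcons.
  by rewrite addnS addSn !ltnS -{3}(addn0 (size s)) leq_add2l leqn0 => /nilP.
rewrite s0 /= in cJ; case/and3P: cJ => /colouredP[i hi] /colouredP[j hj] _.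
have [iC li] := colours_sound hK hi; have [jC lj] := colours_sound hK hj.
exists x, (f c), i, j; rewrite !fK in lj *; split; last by split=> //; rewrite -has_linkC.
split=> //; first by rewrite eq_sym.
apply/negP => /eqP ij; rewrite -ij fK in hj.
have /andP[uK _] := hK.
case: (colours_fun uK hi hj) => /(congr1 fst)/= e1; move: fc.
  by rewrite e1 fx eqxx.
by rewrite -e1 eqxx.
Qed.

End Colouring.
End Colours.

(** * Badges *)

Section Badges.
Variables (V I : finType).
Implicit Types (f : V -> V) (D : V * seq V * V) (C M : {set I}) (Q : I -> V * seq V * V).
Implicit Types (ls : seq (V * V)).

(* [flip] reverses a path. [bar] exchanges the two ends of every matching edge on
   it, that is P^A with P^B. *)
Definition flip f D : V * seq V * V := (D.2, rev (map f D.1.2), D.1.1).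
Definition bar f D : V * seq V * V := (D.1.1, map f D.1.2, D.2).
Definition same f D D' := (D' == D) || (D' == flip f D).
Definition touches f D v := touch f D.1.2 v.

(** A badge without its multigraph: a class of [same] together with its [bar] is a strip. The weight
    of a strip is the number of matching edges on its paths, so [badge_mult] can state the
    multiplicity as the number of nodes. [badge_sep] is the disjointness of the interiors, and
    [badge_cover] makes the skeleton the whole matching. *)
Record badge f Q C : Prop := Badge {
  badge_cover : forall v, f v != v -> exists2 i, i \in C & touches f (Q i) v;
  badge_bar : forall i, i \in C -> exists2 j, j \in C & same f (bar f (Q i)) (Q j);
  badge_mult : forall i, i \in C ->
    #|[set j in C | same f (Q i) (Q j)]| = size (Q i).1.2;
  badge_sep : forall i j v, i \in C -> j \in C -> touches f (Q i) v ->
    touches f (Q j) v -> same f (Q i) (Q j) || same f (bar f (Q i)) (Q j)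
}.

Section Involution.
Variable f : V -> V.
Hypothesis fK : involutive f.

Lemma flipK : involutive (flip f).
Proof. by move=> [[p cs] q]; rewrite /flip /= map_rev revK mapK. Qed.

Lemma barK : involutive (bar f).
Proof. by move=> [[p cs] q]; rewrite /bar /= mapK. Qed.

Lemma bar_flip D : bar f (flip f D) = flip f (bar f D).
Proof. by rewrite /bar /flip /= map_rev. Qed.

Lemma same_refl D : same f D D.
Proof. by rewrite /same eqxx. Qed.

Lemma same_sym D D' : same f D D' = same f D' D.
Proof.
by rewrite /same (eq_sym D'); congr orb; apply/eqP/eqP => ->; rewrite flipK.
Qed.

Lemma same_flip D D' : same f (flip f D) D' = same f D D'.
Proof. by rewrite /same flipK orbC. Qed.

Lemma same_trans D1 D2 D3 : same f D1 D2 -> same f D2 D3 -> same f D1 D3.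
Proof. by case/orP=> /eqP-> //; rewrite same_flip. Qed.

Lemma same_bar D D' : same f (bar f D) (bar f D') = same f D D'.
Proof. by rewrite /same -bar_flip !(inj_eq (inv_inj barK)). Qed.

Lemma has_link_flip D : has_link f (flip f D) =1 has_link f D.
Proof. by move=> l; apply: link_of_rev. Qed.

Lemma same_link D D' : same f D D' -> has_link f D =1 has_link f D'.
Proof. by case/orP=> /eqP-> // l; rewrite has_link_flip. Qed.

Lemma aap_flip D : aap f (flip f D) = aap f D.
Proof.
rewrite /aap /= valid_flip // (eq_sym D.2).
by case: (f D.1.1 == D.1.1); case: (f D.2 == D.2).
Qed.

Lemma same_aap D D' : same f D D' -> aap f D = aap f D'.
Proof. by case/orP=> /eqP-> //; rewrite aap_flip. Qed.

Lemma touches_flip D v : touches f (flip f D) v = touches f D v.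
Proof. by rewrite /touches touch_rev. Qed.

Lemma same_touches D D' : same f D D' -> touches f D =1 touches f D'.
Proof. by case/orP=> /eqP-> // v; rewrite touches_flip. Qed.

Lemma same_size D D' : same f D D' -> size D.1.2 = size D'.1.2.
Proof. by case/orP=> /eqP->; rewrite //= size_rev size_map. Qed.

Lemma same_from p s q s' q' : p != q -> same f (p, s, q) (p, s', q') ->
  s' = s /\ q' = q.
Proof. by move=> pq /orP[]/eqP[] // pq'; rewrite pq' eqxx in pq. Qed.

Lemma bar_not_same D : D.1.1 != D.2 -> valid f D.1.2 -> 0 < size D.1.2 ->
  ~~ same f (bar f D) D.
Proof.
case: D => [[p [//|c s]] q] /= pq; rewrite valid_cons // => /and3P[fc _ _] _.
apply/negP => h; have [] := same_from pq h.
by case=> e; rewrite -e eqxx in fc.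
Qed.

(* The partner of a strip path with one copy missing forces the missing copy. *)
Lemma badge_exchange Q1 Q2 (R : {set I}) i1 i2 : i1 \notin R -> i2 \notin R ->
    badge f Q1 (i1 |: R) -> badge f Q2 (i2 |: R) -> {in R, Q1 =1 Q2} ->
    aap f (Q1 i1) -> same f (Q1 i1) (Q2 i2).
Proof.
move=> n1 n2 b1 b2 e12 /and4P[_ _ pq hv].
have iC1 := setU11 i1 R; have iC2 := setU11 i2 R.
have m1 := badge_mult b1 iC1.
have s1 : 0 < size (Q1 i1).1.2.
  by rewrite -m1; apply/card_gt0P; exists i1; rewrite inE iC1 same_refl.
have [m mC sm] := badge_bar b1 iC1.
have mR : m \in R.
  case/setU1P: mC sm => // ->; by rewrite (negPf (bar_not_same pq hv s1)).
have [k kC sk] := badge_bar b2 (setU1r i2 mR); rewrite -e12 // in sk.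
have s1k : same f (Q1 i1) (Q2 k).
  by apply: same_trans sk; rewrite -[Q1 i1]barK same_bar.
case/setU1P: kC => [<-//|kR].
have m2 := badge_mult b2 (setU1r i2 kR); rewrite -(same_size s1k) -m1 in m2.
apply/negPn/negP => ns.
(* If [Q2 i2] is not a copy, all copies of [Q2 k] lie in [R] and are copies of [Q1 i1], which has
   the further copy [i1]. Yet both classes have the size of the same path. *)
suff : [set j in i2 |: R | same f (Q2 k) (Q2 j)] \proper
       [set j in i1 |: R | same f (Q1 i1) (Q1 j)].
  by move/proper_card; rewrite m2 ltnn.
apply/properP; split.
  apply/subsetP => j; rewrite !inE => /andP[jC sj].
  have s1j := same_trans s1k sj.
  case/orP: jC => [/eqP ej|jR]; last by rewrite jR orbT (e12 j jR).
  by rewrite -ej s1j in ns.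
exists i1; rewrite !inE ?eqxx ?same_refl // (negPf n1) orbF.
apply/negP => /andP[/eqP e sj]; rewrite e in sj.
by rewrite (same_trans s1k sj) in ns.
Qed.

(* Inside its strip, an active vertex [e] can be left towards either end, by a
   path all of whose links lie in as many members as it has links. *)
Lemma badge_tail Q C e x : badge f Q C -> {in C, forall i, aap f (Q i)} -> f e != e ->
  exists t s (M : {set I}), [/\ f t = t, t != x, valid f (e :: s) & size s < #|M|] /\
    forall m, m \in M -> [/\ m \in C, touches f (Q m) e &
      all (has_link f (Q m)) (links f (f e) s t)].
Proof.
move=> bQ aQ fe; have [i iC ie] := badge_cover bQ fe.
have /and4P[/eqP fp /eqP fq pq hv] := aQ i iC.
have [D [sD qx De]] : exists D, [/\ same f D (Q i), D.2 != x & touches f D e].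
  have [qx|qx] := eqVneq (Q i).2 x; last by exists (Q i); rewrite same_refl qx.
  by exists (flip f (Q i)); rewrite same_flip same_refl touches_flip -qx.
(* Either the member or its partner enters the matching edge at [e] and leaves it at [f e]; the
   partner has the same ends. *)
have [k [D' [kC sD' qx' De']]] :
    exists k D', [/\ k \in C, same f D' (Q k), D'.2 != x & e \in D'.1.2].
  case/orP: De => De; first by exists i, D.
  have [k kC sk] := badge_bar bQ iC; exists k, (bar f D); split=> //.
    by apply: same_trans sk; rewrite same_bar.
  by rewrite /= mem_map_inv.
have aD : aap f D' by rewrite (same_aap sD') aQ.
have mD := badge_mult bQ kC; rewrite -(same_size sD') in mD.
case: D' sD' qx' De' aD mD => [[p' cs] t] /= sD' tx es /and4P[/= fp' ft pt vs].
case/splitPr: es vs sD' => s1 s sv sD' mD.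
exists t, s, [set j in C | same f (Q k) (Q j)]; split.
  split=> //; first exact/eqP.
    by move: sv; rewrite valid_cat // => /and3P[].
  by rewrite mD size_cat /= addnS ltnS leq_addl.
move=> m; rewrite inE => /andP[mC sm]; have sDm := same_trans sD' sm.
split=> //; first by rewrite -(same_touches sDm) /touches /touch /= mem_cat mem_head orbT.
apply/allP => l hl; rewrite -(same_link sDm); apply/orP; left.
by rewrite links_cat mem_cat hl orbT.
Qed.

Lemma root_link D x c : aap f D -> f x = x -> f c != c -> has_link f D (x, c) ->
  exists s y, same f (x, c :: s, y) D.
Proof.
move=> aD fx fc; wlog : D aD / (x, c) \in dlinks f D.
  move=> wl; case/orP=> h; first by apply: wl => //; apply/orP; left.
  have hD : (x, c) \in dlinks f (flip f D).
    by rewrite /dlinks /= links_rev // mem_rev -[(x, c)]swapK; apply: map_f.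
  case: (wl (flip f D)) => //; first by rewrite aap_flip.
    by rewrite /has_link /link_of inE [X in X || _]hD.
  by move=> s [y h0]; exists s, y; rewrite same_sym same_flip same_sym in h0.
case: D aD => [[p cs] q] /and4P[/= fp /eqP fq pq hv] h _.
have px : x = p.
  have [] := linksP h; rewrite inE /= mem_map_inv // fx => /orP[/eqP//|xcs] _.
  by rewrite (negPf (valid_notin fK hv fx)) in xcs.
move: fc; rewrite -px {p px fp pq} in h *; case: cs hv h => [|d s] hv.
  by rewrite inE => /eqP[->]; rewrite fq eqxx.
rewrite inE => /orP[/eqP[->] _|/linksP[]].
  by exists s, q; rewrite same_refl.
have xs := valid_notin fK hv fx; rewrite -map_cons mem_map_inv // fx /=.
by rewrite (negPf xs).
Qed.

Lemma colourable_rev Q C p cs q : colourable f Q C (links f p cs q) ->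
  colourable f Q C (links f q (rev (map f cs)) p).
Proof.
move=> [s [us sC hs]]; exists (rev s); split.
- by rewrite rev_uniq.
- by move=> i; rewrite mem_rev => /sC.
rewrite links_rev //; move: (links f p cs q) hs => ls; rewrite !all2E !size_rev size_map.
case/andP=> /eqP e h; rewrite e eqxx -rev_zip ?size_map // all_rev.
elim: s ls {us sC} e h => [|i s IH] [|l ls] //= [e] /andP[h1 h2].
by rewrite has_linkC h1 IH.
Qed.

End Involution.
End Badges.

(** * Contraction of a triangle at a root *)

Section ContractTriangle.
Variables (V I : finType) (f : V -> V) (Q : I -> V * seq V * V) (C : {set I}).
Variables (x : V) (S : {set V}).
Hypotheses (fK : involutive f) (aapQ : {in C, forall i, aap f (Q i)}).
Hypotheses (free : rainbow_free f Q C) (cardC : #|C| = #|[pred v | f v != v]|).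
Hypotheses (fx : f x = x) (S_pair : {in S, forall a, S = [set a; f a]}).
Hypothesis S_active : {in S, forall a, f a != a}.
Hypothesis S_link : {in S, forall a, exists2 i, i \in C & has_link f (Q i) (x, a)}.
Hypothesis IH : forall g (Q' : I -> V * seq V * V) (C' : {set I}), #|C'| < #|C| ->
  involutive g -> {in C', forall i, aap g (Q' i)} -> rainbow_free g Q' C' ->
  #|C'| = #|[pred v | g v != v]| -> badge g Q' C'.

Let g := freeze f S.

Lemma S_closed v : (f v \in S) = (v \in S).
Proof.
apply/idP/idP => vS; last by rewrite (S_pair vS) !inE eqxx orbT.
by rewrite (S_pair vS) fK !inE eqxx orbT.
Qed.

Let gK : involutive g. Proof. exact: freezeK fK S_closed. Qed.

(** The hypotheses on [S] do not distinguish [a] from [f a], so what is shown for [at_root a] can be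
    applied to [at_root (f a)]. *)
Definition at_root a := [set l in C | has_link f (Q l) (x, a)].

Lemma at_rootP l a : a \in S -> l \in at_root a -> exists s y,
  [/\ same f (x, a :: s, y) (Q l), y != x, f y = y, valid f (a :: s) &
      {in s, forall v, v \notin S}].
Proof.
move=> aS; rewrite inE => /andP[lC h].
have [s [y sD]] := root_link fK (aapQ lC) fx (S_active aS) h.
exists s, y; have := aapQ lC; rewrite -(same_aap fK sD) => /and4P[_ /eqP/= fy xy hv].
split=> //; first by rewrite eq_sym.
by move: hv; rewrite valid_cons // => /and3P[_ /touch_pairPn]; rewrite -(S_pair aS).
Qed.

(** A path has only one link at its end [x]. *)
Lemma at_root_disjoint l a : a \in S -> l \in at_root a -> l \notin at_root (f a).
Proof.
move=> aS la; have [s [y [sD yx fy hv sS]]] := at_rootP aS la.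
move: la; rewrite !inE => /andP[-> _] /=; rewrite -(same_link fK sD) /has_link /link_of /=.
have fa := S_active aS.
apply/negP => /orP[]; rewrite !inE => /orP[].
- by move/eqP => [e]; rewrite e eqxx in fa.
- case/linksP; rewrite -map_cons mem_map_inv // fx => h _.
  by rewrite (negPf (valid_notin fK hv fx)) in h.
- move/eqP => [e _]; have ea : a = x by rewrite -[a]fK e fx.
  by rewrite ea fx eqxx in fa.
- case/linksP=> _; rewrite /= mem_rcons inE eq_sym (negPf yx) /= => h.
  by have := sS _ h; case/negP: (valid_notin fK hv fx); rewrite inE h orbT.
Qed.

(** A relation rather than a function: a member that meets the triangle and has neither end at [x]
    leaves a valid contraction on each side. This freedom is used in [touches_at_root]. *)
Definition contracts l D :=
  aap g D && all (image_links x S (has_link f (Q l))) (dlinks g D).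

Lemma contracts_links l p s q D : l \in C -> same f D (Q l) ->
    g (collapse x S p) = collapse x S p -> g (collapse x S q) = collapse x S q ->
    collapse x S p != collapse x S q -> valid f s -> {in s, forall v, v \notin S} ->
    all (has_link f D) (links f p s q) ->
  contracts l (collapse x S p, s, collapse x S q).
Proof.
move=> lC sD gp gq pq vs sS hl; apply/andP; split.
  apply/and4P; split; rewrite //= ?gp ?gq //.
  by apply/(valid_freezeP fK S_closed).
apply: all_image_links => //; first exact: S_closed.
by rewrite -(eq_all (same_link fK sD)).
Qed.

Let g_root v : f v = v -> g v = v.
Proof. by move=> fv; rewrite /g freeze_notin // (root_notin S_active). Qed.

Let c_root v : f v = v -> collapse x S v = v.
Proof. by move=> fv; rewrite collapse_notin // (root_notin S_active). Qed.

Lemma contracts_untouched l : l \in C -> {in (Q l).1.2, forall v, v \notin S} ->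
  contracts l (Q l).
Proof.
move=> lC; have := aapQ lC; case e: (Q l) => [[p s] q] /and4P[/= /eqP fp /eqP fq pq hv] sS.
rewrite -{1}(c_root fp) -{1}(c_root fq).
apply: (contracts_links lC (same_refl f (Q l))); rewrite ?c_root ?g_root //.
by rewrite e; apply/allP => l' hl; apply/orP; left.
Qed.

Lemma contracts_tail l p s1 c s2 q : l \in C -> same f (p, s1 ++ c :: s2, q) (Q l) ->
  c \in S -> q != x -> contracts l (x, s2, q).
Proof.
move=> lC sD cS qx; have := aapQ lC; rewrite -(same_aap fK sD).
case/and4P=> /= /eqP fp /eqP fq pq; rewrite valid_cat // => /and3P[_ hv _].
move: hv; rewrite valid_cons // => /and3P[_ /touch_pairPn sS hv].
rewrite -(S_pair cS) in sS.
have e : x = collapse x S (f c) by rewrite /collapse S_closed cS.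
rewrite {1}e -{1}(c_root fq); apply: (contracts_links lC sD) => //.
- by rewrite -e g_root.
- by rewrite c_root ?g_root.
- by rewrite -e c_root // eq_sym.
- by apply/allP => l' hl; apply/orP; left; rewrite links_cat mem_cat hl orbT.
Qed.

Lemma contracts_head l p s1 c s2 q : l \in C -> same f (p, s1 ++ c :: s2, q) (Q l) ->
  c \in S -> p != x -> contracts l (p, s1, x).
Proof.
move=> lC sD cS px; have := aapQ lC; rewrite -(same_aap fK sD).
case/and4P=> /= /eqP fp /eqP fq pq; rewrite -cat_rcons valid_cat // => /and3P[hv _ _].
move: hv; rewrite valid_rcons // valid_cons // => /and3P[_ /touch_pairPn sS hv].
rewrite -(S_pair cS) in sS.
have e : x = collapse x S c by rewrite /collapse cS.
rewrite {1}e -{1}(c_root fp); apply: (contracts_links lC sD) => //.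
- by rewrite c_root ?g_root.
- by rewrite -e g_root.
- by rewrite -e c_root.
- by apply/allP => l' hl; apply/orP; left; rewrite links_cat mem_cat hl.
Qed.

Lemma touches_split D a : a \in S -> touches f D a -> exists2 c, c \in S &
  exists s1 s2, D.1.2 = s1 ++ c :: s2.
Proof.
move=> aS /orP[]/splitPr[s1 s2]; [exists a|exists (f a)];
  rewrite ?S_closed //; by exists s1, s2.
Qed.

Lemma untouchedP D a : a \in S ->
  reflect {in D.1.2, forall v, v \notin S} (~~ touches f D a).
Proof.
by move=> aS; apply: (iffP (touch_pairPn f a _)) => h v /h; rewrite -(S_pair aS).
Qed.

Lemma contracts_ex l : exists D, l \in C -> contracts l D.
Proof.
case: (boolP (l \in C)) => [lC|]; last by exists (Q l).
case: (set_0Vmem S) => [S0|[a aS]].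
  by exists (Q l) => _; apply: contracts_untouched => // v _; rewrite S0 inE.
case: (boolP (touches f (Q l) a)) => [/(touches_split aS)|/(untouchedP _ aS) h]; last first.
  by exists (Q l) => _; apply: contracts_untouched.
case=> c cS [s1 [s2 e]]; have sD : same f ((Q l).1.1, s1 ++ c :: s2, (Q l).2) (Q l).
  by rewrite -e; case: (Q l) => [[]] *; rewrite same_refl.
have [px|px] := eqVneq (Q l).1.1 x; last first.
  by exists ((Q l).1.1, s1, x) => _; apply: contracts_head sD _ _.
exists (x, s2, (Q l).2) => _; apply: contracts_tail sD _ _ => //.
by rewrite -px eq_sym; have /and4P[] := aapQ lC.
Qed.

Lemma contracts_link l D e : contracts l D -> has_link g D e ->
  image_links x S (has_link f (Q l)) e.
Proof.
have sy := image_links_sym x S (has_linkC f (Q l)).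
by case/andP=> _ /allP h /orP[/h//|/h]; rewrite sy.
Qed.

Lemma contracts_link_out l D e : contracts l D -> has_link g D e ->
  e.1 != x -> e.2 != x -> has_link f (Q l) e.
Proof.
move=> cD /(contracts_link cD)/existsP[[u v] /andP[h /eqP]]; case: e => e1 e2 [].
by move=> h1 h2 /= /collapse_neq/(_ h1)<- /collapse_neq/(_ h2)<-.
Qed.

(** A rainbow path of the contraction lifts to links starting at some [p0]. If [p0] lies in the
    triangle, the link from [x] to [f p0] and the matching edge complete it, and that link has one
    of the reserved colours [i], [j]. *)
Lemma contracts_free i j Q' a : a \in S -> i \in at_root a -> j \in at_root (f a) ->
  (forall l, l \in C -> contracts l (Q' l)) ->
  rainbow_free g Q' (C :\ i :\ j).
Proof.
move=> aS ia jb hQ' [[p cs] q] /and4P[/= /eqP gp /eqP gq pq hv] hc.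
rewrite /dlinks /= in hc; have [s [us sC hs]] := hc.
have hs0 ls : all2 (fun i l => has_link g (Q' i) l) s ls ->
    all (fun l => (l.1 \notin S) && (l.2 \notin S)) ls.
  elim: s sC {us hs hc} ls => [|k s IHs] sC [|l ls] //= /andP[h /IHs ->].
    rewrite andbT; have kC : k \in C by have := sC k (mem_head _ _); rewrite !inE => /and3P[].
    have /existsP[l0 /andP[_ /eqP<-]] := contracts_link (hQ' k kC) h.
    by rewrite /= !(collapse_out fx S_active).
  by move=> k' h'; apply: sC; rewrite inE h' orbT.
have /allP out := hs0 _ hs.
have pS : p \notin S.
  by case: (cs) out => [|c s'] /(_ _ (mem_head _ _))/andP[].
have qS : q \notin S by have /andP[] := out _ (links_last_mem g p cs q).
have fp : f p = p by move: gp; rewrite /g freeze_notin.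
have fq : f q = q by move: gq; rewrite /g freeze_notin.
wlog qx : p cs q gp gq pq hv hc s us sC hs fp fq pS qS {hs0 out} / q != x.
  move=> wl; have [qx|qx] := eqVneq q x; last exact: (wl p cs q gp gq pq hv hc s).
  have hc' := colourable_rev gK hc; have [s' [us' sC' hs']] := hc'.
  apply: (wl q (rev (map g cs)) p gq gp _ _ hc' s') => //; first by rewrite eq_sym.
    by rewrite valid_flip.
  by rewrite -qx.
have [hv1 hv2] : valid f cs /\ {in cs, forall v, v \notin S}.
  by apply/(valid_freezeP fK S_closed).
have [ls0 e0 h0] : exists2 ls0, map (collapse2 x S) ls0 = links g p cs q &
    all2 (fun i l => has_link f (Q i) l) s ls0.
  elim: s (links g p cs q) sC hs {us} => [|k s IHs] [|l ls] sC //=; first by exists [::].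
  case/andP=> h hs; have [|ls0 e h0] := IHs ls _ hs.
    by move=> k' h'; apply: sC; rewrite inE h' orbT.
  have kC : k \in C by have := sC k (mem_head _ _); rewrite !inE => /and3P[].
  have /existsP[l0 /andP[h1 /eqP h2]] := contracts_link (hQ' k kC) h.
  by exists (l0 :: ls0); rewrite /= ?e ?h2 ?h1.
rewrite links_freeze // in e0.
have [p0 ep el] := lift_links fK fx e0 qx hv2 (valid_notin fK hv1 fx).
have hr : colourable f Q (C :\ i :\ j) (links f p0 cs q) by exists s; rewrite -el.
case: (boolP (p0 \in S)) => p0S; last first.
  move: ep; rewrite collapse_notin // => p0p; rewrite p0p in hr.
  apply: (free (D := (p, cs, q))); first by rewrite /aap /= fp fq !eqxx pq.
  by apply: colourable_sub hr; rewrite !subDset !setUA subsetUr.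
have px : p = x by rewrite -ep /collapse p0S.
have [k [kC kl hk]] : exists k,
    [/\ k \in C, has_link f (Q k) (x, f p0) & C :\ i :\ j \subset C :\ k].
  move: p0S; rewrite (S_pair aS) !inE => /orP[]/eqP ->.
    exists j; move: jb; rewrite inE => /andP[jC h]; split=> //.
    by apply/subsetP => m; rewrite !inE => /and3P[-> _ ->].
  exists i; move: ia; rewrite inE => /andP[iC h]; rewrite fK; split=> //.
  by apply/subsetP => m; rewrite !inE => /and3P[_ -> ->].
apply: (free (D := (x, f p0 :: cs, q))).
  apply/and4P; split; rewrite /= ?fx ?fq ?eqxx // 1?eq_sym //.
  rewrite valid_cons // fK eq_sym S_active //= hv1 andbT touchf //.
  by apply/touch_pairPn; rewrite -(S_pair p0S).
rewrite /dlinks /= fK; apply: (colourable_cons kC kl).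
exact: colourable_sub hr.
Qed.

(** Two colours and two covered vertices disappear, so the extremal equality persists and the
    induction hypothesis applies. The choice of [i], [j] and [Q'] is left open: the exchange
    arguments vary it. *)
Lemma contracts_badge i j Q' a : a \in S -> i \in at_root a -> j \in at_root (f a) ->
  (forall l, l \in C -> contracts l (Q' l)) -> badge g Q' (C :\ i :\ j).
Proof.
move=> aS ia jb hQ'.
have iC : i \in C by move: ia; rewrite inE => /andP[].
have jC : j \in C :\ i.
  rewrite !inE; move: (jb); rewrite inE => /andP[-> _]; rewrite andbT.
  by apply: contraTneq jb => ->; apply: at_root_disjoint.
have c1 : #|C| = #|C :\ i :\ j|.+2 by rewrite (cardsD1 i) iC (cardsD1 j) jC.
apply: IH => //; first by rewrite c1.
- by move=> l; rewrite !inE => /and3P[_ _ /hQ'/andP[]].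
- exact: (contracts_free aS ia jb hQ').
have cS : #|S| = 2 by rewrite (S_pair aS) cards2 eq_sym S_active.
by have := card_active_freeze S_active; rewrite -cardC c1 cS addn2 => -[].
Qed.

Lemma contracts_family : exists Q' : I -> V * seq V * V, forall l, l \in C -> contracts l (Q' l).
Proof. by have [Q' h] := fin_all_exists contracts_ex; exists Q'. Qed.

Definition update (Q' : I -> V * seq V * V) l D := fun m => if m == l then D else Q' m.

Lemma contracts_update Q' l D : (forall m, m \in C -> contracts m (Q' m)) ->
  contracts l D -> forall m, m \in C -> contracts m (update Q' l D m).
Proof. by move=> h hD m mC; rewrite /update; case: eqP => [->//|_]; apply: h. Qed.

(** [badge_tail] read before contraction. Only a link at [x] can stem from a link at the triangle,
    and on a tail leaving [f e] the vertex [x] can occur only as the last one. *)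
Lemma contracts_tail_free i j Q' a e y : a \in S -> i \in at_root a ->
    j \in at_root (f a) -> (forall l, l \in C -> contracts l (Q' l)) ->
    e \notin S -> f e != e ->
  exists t s (M : {set I}), [/\ f t = t, t != y, valid f (e :: s),
      {in e :: s, forall v, v \notin S} & size s < #|M|] /\
    forall m, m \in M -> [/\ m \in C :\ i :\ j, touches f (Q' m) e,
      all (has_link g (Q' m)) (links f (f e) s t) &
      forall l, l \in links f (f e) s t -> l.2 != x -> has_link f (Q m) l].
Proof.
move=> aS ia jb hQ eS fe; have bQ := contracts_badge aS ia jb hQ.
have ge : g e = f e by rewrite /g freeze_notin.
have aQ : {in C :\ i :\ j, forall m, aap g (Q' m)}.
  by move=> m; rewrite !inE => /and3P[_ _ /hQ/andP[]].
have [|t [s [M [[gt ty vs sM] hM]]]] := badge_tail gK y bQ aQ (_ : g e != e).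
  by rewrite ge.
have [vs1 vs2] : valid f (e :: s) /\ {in e :: s, forall v, v \notin S}.
  by apply/(valid_freezeP fK S_closed).
have el : links g (g e) s t = links f (f e) s t.
  by rewrite /g links_freeze -/g ?ge // => v vs3; rewrite vs2 // inE vs3 orbT.
have memC m : m \in C :\ i :\ j -> m \in C by rewrite !inE => /and3P[].
have tS : t \notin S.
  have [m mM] : exists m, m \in M by apply/card_gt0P; apply: leq_ltn_trans sM.
  have [/memC mC _ hl] := hM m mM.
  have := contracts_link (hQ m mC) _ (e := (last (g e) (map g s), t)).
  rewrite (allP hl _ (links_last_mem g (g e) s t)) => /(_ isT).
  by case/existsP=> l0 /andP[_ /eqP[_ <-]]; exact: (collapse_out fx S_active).
have ft : f t = t by move: gt; rewrite /g freeze_notin.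
exists t, s, M; split=> // m mM; have [mC te hl] := hM m mM.
split=> //; last 2 first.
- by rewrite -el.
- move=> l' hl' h2; rewrite el in hl.
  apply: (contracts_link_out (hQ m (memC m mC)) (allP hl l' hl')) => //.
  have [h1 _] := linksP hl'; apply: contraTneq h1 => ->.
  by rewrite -map_cons mem_map_inv // fx; apply: valid_notin fx.
case/and4P: (aQ m mC) => _ _ _ /(valid_freezeP fK S_closed)[_ hS].
by move: te; rewrite /touches /touch ge.
Qed.

(** If neither end of the member is [x], the pieces before and after the triangle both complete the
    same remaining members to a badge, so by [badge_exchange] they agree; but their ends differ. If
    it starts at [x] and enters the triangle later, its first link and a tail of the contracted
    badge form a rainbow path. *)
Lemma touches_at_root l a : l \in C -> a \in S -> touches f (Q l) a ->
  (l \in at_root a) || (l \in at_root (f a)).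
Proof.
move=> lC aS ta.
have [i iC hi] := S_link aS; have [j jC hj] : exists2 j, j \in C & has_link f (Q j) (x, f a).
  by apply: S_link; rewrite S_closed.
have ia : i \in at_root a by rewrite inE iC.
have jb : j \in at_root (f a) by rewrite inE jC.
have [li|li] := eqVneq l i; first by rewrite li ia.
have [lj|lj] := eqVneq l j; first by rewrite lj jb orbT.
have lCij : l \in C :\ i :\ j by rewrite !inE lj li lC.
have [c cS [s1 [s2 e]]] := touches_split aS ta.
have sD : same f ((Q l).1.1, s1 ++ c :: s2, (Q l).2) (Q l).
  by rewrite -e; case: (Q l) => [[]] *; rewrite same_refl.
move: (Q l).1.1 (Q l).2 sD => p q {e ta} sD.
have aD := aapQ lC; rewrite -(same_aap fK sD) in aD.
have /and4P[/= /eqP fp /eqP fq pq hv] := aD.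
have [Q0 hQ0] := contracts_family.
wlog px : p q c s1 s2 cS sD fp fq pq hv {aD} / p = x.
  move=> wl; have [px|px] := eqVneq p x; first exact: (wl p q c s1 s2).
  have [qx|qx] := eqVneq q x.
    apply: (wl q p (f c) (rev (map f s2)) (rev (map f s1))) => //.
    - by rewrite S_closed.
    - move: sD; rewrite -same_flip // /flip /= map_cat rev_cat rev_cons.
      by rewrite cat_rcons.
    - by rewrite eq_sym.
    by move: hv; rewrite -(valid_flip fK) map_cat rev_cat rev_cons cat_rcons.
  have h1 := contracts_update hQ0 (contracts_head lC sD cS px).
  have h2 := contracts_update hQ0 (contracts_tail lC sD cS qx).
  have b1 := contracts_badge aS ia jb h1; have b2 := contracts_badge aS ia jb h2.
  rewrite -(setD1K lCij) in b1 b2.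
  have nl : l \notin C :\ i :\ j :\ l by rewrite !inE eqxx.
  have ag : {in C :\ i :\ j :\ l, update Q0 l (p, s1, x) =1 update Q0 l (x, s2, q)}.
    by move=> m; rewrite !inE /update => /andP[/negPf-> _].
  have a1 : aap g (update Q0 l (p, s1, x) l).
    by rewrite /update eqxx; have /andP[] := contracts_head lC sD cS px.
  have := badge_exchange gK nl nl b1 b2 ag a1.
  rewrite /same /update !eqxx => /orP[]/eqP e.
    by have := congr1 (fun D => D.1.1) e => /= e1; rewrite e1 eqxx in px.
  by have := congr1 snd e => /= e1; rewrite e1 eqxx in pq.
rewrite px {px} in sD fp pq; have qx : q != x by rewrite eq_sym.
case: s1 sD hv => [|e s1] sD hv.
  have ac : l \in at_root c.
    by rewrite inE lC -(same_link fK sD); apply/orP; left; rewrite mem_head.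
  by move: cS ac; rewrite (S_pair aS) !inE => /orP[]/eqP-> ->; rewrite ?orbT.
(* From the first node [e] one can walk inside the contracted badge to a root
   other than [x], and the first link of member [l] completes the path. *)
have hQ := contracts_update hQ0 (contracts_tail lC sD cS qx).
move: hv; rewrite cat_cons valid_cons // => /and3P[fe]; rewrite touch_cat // negb_or.
case/andP=> _ te _.
have eS : e \notin S.
  apply: contra te => eS; move: cS; rewrite (S_pair eS) !inE /touch !inE (eq_sym c).
  by rewrite (eq_sym c) => /orP[]->; rewrite ?orbT.
have [t [s [M [[ft tx vs vS sM] hM]]]] := contracts_tail_free x aS ia jb hQ eS fe.
have lM m : m \in M -> m != l.
  move=> /hM[_ te' _ _]; apply: contraNneq te => ml; move: te'.
  rewrite ml /update eqxx /touches /touch /= => h.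
  by rewrite !inE; case/orP: h => ->; rewrite ?orbT.
case: (free (D := (x, e :: s, t))).
  by rewrite /aap /= fx ft !eqxx eq_sym tx.
rewrite /dlinks /=; apply: (@colourable_cons _ _ _ _ _ l) => //.
  by rewrite -(same_link fK sD); apply/orP; left; rewrite mem_head.
apply: (@colourable_sub _ _ _ _ M).
  apply/subsetP => m mM; rewrite !inE (lM m mM); have [mC _ _ _] := hM m mM.
  by move: mC; rewrite !inE => /and3P[].
apply: colourable_all; last by rewrite size_links.
move=> m mM; have [_ _ _ hl] := hM m mM.
apply/allP => l' hl'; apply: hl => //; have [_ h2] := linksP hl'.
apply: contraTneq h2 => ->; rewrite mem_rcons inE negb_or eq_sym tx.
by have := valid_notin fK vs fx; rewrite inE negb_or => /andP[].
Qed.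

(* A member meeting [S] has [x] as an end and a first link into [S], by
   [touches_at_root]; hence the contraction of a member is determined. *)
Definition cut l D :=
  ({in (Q l).1.2, forall v, v \notin S} /\ D = Q l) \/
  exists c s y, [/\ c \in S, l \in at_root c, same f (x, c :: s, y) (Q l) & D = (x, s, y)].

Lemma cut_ex a : a \in S -> exists Q' : I -> V * seq V * V, forall l, l \in C -> cut l (Q' l).
Proof.
move=> aS; apply: (@fin_all_exists I _ (fun l D => l \in C -> cut l D)) => l.
case: (boolP (l \in C)) => [lC|]; last by exists (Q l).
case: (boolP (touches f (Q l) a)) => [ta|/(untouchedP _ aS) h]; last first.
  by exists (Q l) => _; left.
have [c cS lc] : exists2 c, c \in S & l \in at_root c.
  case/orP: (touches_at_root lC aS ta) => h; first by exists a.
  by exists (f a); rewrite ?S_closed.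
have [s [y [sD _ _ _ _]]] := at_rootP cS lc.
by exists (x, s, y) => _; right; exists c, s, y.
Qed.

Lemma cut_contracts l D : l \in C -> cut l D -> contracts l D.
Proof.
move=> lC [[h ->]|[c [s [y [cS lc sD ->]]]]]; first exact: contracts_untouched.
apply: (contracts_tail (s1 := [::]) lC sD cS).
by have := aapQ lC; rewrite -(same_aap fK sD) => /and4P[_ _ /=]; rewrite eq_sym.
Qed.

(** * The strip through the triangle *)

Section Cut.
Variable Q' : I -> V * seq V * V.
Hypothesis cutQ : forall l, l \in C -> cut l (Q' l).

Let contrQ l (lC : l \in C) : contracts l (Q' l) := cut_contracts lC (cutQ lC).

Lemma at_root_member a l : l \in at_root a -> l \in C.
Proof. by rewrite inE => /andP[]. Qed.

Lemma same_at_root a s y l : l \in C -> same f (x, a :: s, y) (Q l) -> l \in at_root a.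
Proof.
by move=> lC sD; rewrite inE lC -(same_link fK sD); apply/orP; left; rewrite mem_head.
Qed.

Lemma S_pairE a v : a \in S -> v \in S -> v = a \/ v = f a.
Proof. by move=> aS; rewrite (S_pair aS) !inE => /orP[]/eqP->; [left|right]. Qed.

Lemma cut_at_root a l : a \in S -> l \in at_root a -> exists s y,
  [/\ y != x, f y = y, valid f (a :: s), {in s, forall v, v \notin S} &
      same f (x, a :: s, y) (Q l) /\ Q' l = (x, s, y)].
Proof.
move=> aS la; have [s [y [sD yx fy vs sS]]] := at_rootP aS la.
have lC := at_root_member la; case: (cutQ lC) => [[h _]|[c [s' [y' [cS lc sD' e]]]]].
  have /(untouchedP _ aS) : {in (Q l).1.2, forall v, v \notin S} by [].
  by rewrite -(same_touches fK sD) /touches /touch mem_head.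
have ca : c = a.
  case: (S_pairE aS cS) => // ca; rewrite ca in lc.
  by have := at_root_disjoint aS la; rewrite lc.
rewrite ca in sD'; have xy : x != y by rewrite eq_sym.
have sDD : same f (x, a :: s, y) (x, a :: s', y').
  by apply: (same_trans fK sD); rewrite same_sym.
have [[es] ey] := same_from xy sDD.
by exists s, y; rewrite e es ey.
Qed.

Lemma cut_untouched a l : a \in S -> l \in C -> l \notin at_root a ->
  l \notin at_root (f a) -> {in (Q l).1.2, forall v, v \notin S} /\ Q' l = Q l.
Proof.
move=> aS lC la lb; case: (cutQ lC) => [//|[c [s [y [cS lc _ _]]]]].
by case: (S_pairE aS cS) lc => ->; [rewrite (negPf la)|rewrite (negPf lb)].
Qed.

Lemma other_member a i : a \in S -> i \in at_root a ->
  exists2 j, j \in at_root (f a) & j != i.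
Proof.
move=> aS ia; have bS : f a \in S by rewrite S_closed.
have [j jC hj] := S_link bS.
have jb : j \in at_root (f a) by rewrite inE jC.
exists j => //; apply: contraTneq jb => ->; exact: at_root_disjoint.
Qed.

(** Dropping [i] and dropping [l], with the same [j], leave badges that differ in one member
    only. *)
Lemma at_root_same a i l : a \in S -> i \in at_root a -> l \in at_root a -> Q' l = Q' i.
Proof.
move=> aS ia la; have [->//|li] := eqVneq l i.
have [j jb ji] := other_member aS ia.
have jl : j != l.
  by apply: contraTneq jb => ->; apply: at_root_disjoint.
have := contracts_badge aS ia jb contrQ; have := contracts_badge aS la jb contrQ.
have e1 : C :\ l :\ j = i |: (C :\ l :\ j :\ i).
  by rewrite setD1K // !inE (eq_sym i) ji (eq_sym i) li (at_root_member ia).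
have e2 : C :\ i :\ j = l |: (C :\ l :\ j :\ i).
  apply/setP => k; rewrite !inE; have [->|kl] := eqVneq k l.
    by rewrite eq_sym jl li (at_root_member la).
  by rewrite /= andbCA.
rewrite e1 e2 => b1 b2.
have := badge_exchange gK _ _ b1 b2 (fun _ _ => erefl _).
rewrite !inE !eqxx /= !andbF => /(_ isT isT).
have [s [y [yx fy vs sS [sD e]]]] := cut_at_root aS ia.
have [s' [y' [yx' fy' vs' sS' [sD' e']]]] := cut_at_root aS la.
rewrite e e'; have /andP[aD _] := contrQ (at_root_member ia); rewrite e in aD.
by rewrite eq_sym in yx => /(_ aD)/(same_from yx)[-> ->].
Qed.

Definition tail_form a A y := [/\ y != x, f y = y, valid f (a :: A),
  {in A, forall v, v \notin S} &
  forall l, l \in at_root a -> same f (x, a :: A, y) (Q l) /\ Q' l = (x, A, y)].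

Lemma tail_form_ex a : a \in S -> exists A y, tail_form a A y.
Proof.
move=> aS; have [i iC hi] := S_link aS.
have ia : i \in at_root a by rewrite inE iC.
have [s [y [yx fy vs sS [sD e]]]] := cut_at_root aS ia; exists s, y; split=> // l la.
have [s' [y' [_ _ _ _ [sD' e']]]] := cut_at_root aS la.
by move: e'; rewrite (at_root_same aS ia la) e => -[-> ->].
Qed.

Lemma at_root_ex a : a \in S -> exists i, i \in at_root a.
Proof. by move=> aS; have [i iC hi] := S_link aS; exists i; rewrite inE iC. Qed.

Lemma tail_link a A y l e : tail_form a A y -> l \in at_root a ->
  e \in links f x (a :: A) y -> has_link f (Q l) e.
Proof. by case=> _ _ _ _ h /h[sD _] he; rewrite -(same_link fK sD); apply/orP; left. Qed.

Lemma has_link_freeze D : {in D.1.2, forall v, v \notin S} -> has_link g D =1 has_link f D.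
Proof. by move=> h l; rewrite /has_link /link_of !inE /g links_freeze. Qed.

(** The dropped colour [i] is free to colour the last link of its own path, between [f h] and [y].
    Entering the edge at [f h] from [y], one continues from [h] along a tail of the contracted badge
    to a root other than [y]. If [i] were alone, this would always yield a rainbow path; the only
    delicate end is [x], whose links may be images of links at the triangle. *)
Lemma at_root_two a A y i : a \in S -> tail_form a A y -> A != [::] -> i \in at_root a ->
  exists2 l, l \in at_root a & l != i.
Proof.
move=> aS hA A0 ia; have [yx fy vA AS _] := hA; have [j jb ji] := other_member aS ia.
case: (boolP [exists l in at_root a, l != i]) => [/exists_inP[l la li]|]; first by exists l.
rewrite negb_exists_in => /forall_inP/= only; case: notF.
case/lastP: A A0 hA vA AS => // A h _ hA vA AS.
have hS : f h \notin S by rewrite S_closed AS // mem_rcons mem_head.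
have fh : f (f h) != f h.
  by rewrite fK eq_sym (valid_active fK vA) // /touch inE mem_rcons mem_head orbT.
have [t [s [M [[ft ty vs vS sM] hM]]]] := contracts_tail_free y aS ia jb contrQ hS fh.
rewrite fK in hM.
have yh : has_link f (Q i) (y, f h).
  rewrite -has_linkC; apply: (tail_link hA ia).
  by rewrite -rcons_cons links_rcons mem_rcons mem_head.
have jC := at_root_member jb.
have MC m : m \in M -> m \in C :\ i :\ j by case/hM.
have xs : x \notin f h :: s by apply: valid_notin fx.
have [ls el er] := links_lastE f h s t.
have lsx l : l \in ls -> l.2 != x.
  move=> hl; have := links_snd f h s t; rewrite el map_rcons => /rcons_inj/(congr1 fst)/= e.
  by apply: contra xs => /eqP <-; rewrite inE -e (map_f snd hl) orbT.
have zs : size ls = size s.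
  by have := size_links f h s t; rewrite el size_rcons => -[].
have [tx|tx] := eqVneq t x; last first.
  case: (free (D := (y, f h :: s, t))).
    by rewrite /aap /= fy ft !eqxx eq_sym ty.
  rewrite /dlinks /= fK; apply: (colourable_cons (at_root_member ia)) => //.
  apply: (@colourable_sub _ _ _ _ M).
    by apply/subsetP => m /MC; rewrite !inE => /and3P[_ -> ->].
  apply: colourable_all; last by rewrite size_links.
  move=> m mM; have [_ _ _ hl] := hM m mM.
  apply/allP => l' hl'; apply: hl => //; have [_ h2] := linksP hl'.
  apply: contraTneq h2 => ->; rewrite mem_rcons inE negb_or eq_sym tx.
  by move: xs; rewrite inE negb_or => /andP[].
rewrite tx in el hM.
have lsM m : m \in M -> all (has_link f (Q m)) ls.
  move=> /hM[_ _ _ hl]; apply/allP => l hls; apply: hl; last exact: lsx.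
  by rewrite el mem_rcons inE hls orbT.
set w := last h (map f s) in el er.
have wM m : m \in M -> has_link g (Q' m) (w, x).
  by case/hM=> _ _ /allP h0 _; apply: h0; rewrite el mem_rcons mem_head.
have sub m : m \in M -> M :\ m \subset C :\ i :\ j :\ m.
  by move=> mM; apply/subsetP => k; rewrite !inE => /andP[-> /MC]; rewrite !inE.
have hls m : m \in M -> colourable f Q (C :\ i :\ j :\ m) ls.
  move=> mM; apply: (colourable_sub (sub m mM)); apply: colourable_all.
    by move=> k; rewrite !inE => /andP[_ /lsM].
  by move: sM; rewrite zs (cardsD1 m) mM.
(* As [i] is alone, such a member avoids the triangle, so its link to [x] exists before contraction
   and the tail can be used unchanged. *)
case: (boolP [exists m in M, m \notin at_root (f a)]) => [/exists_inP[m mM mb]|].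
  have mCij := MC m mM; have mC : m \in C by move: mCij; rewrite !inE => /and3P[].
  have ma : m \notin at_root a.
    apply/negP => /only; move: mCij; rewrite !inE => /and3P[_ -> _] //.
  have [untch eQ] := cut_untouched aS mC ma mb.
  case: (free (D := (y, f h :: s, x))).
    by rewrite /aap /= fy fx !eqxx yx.
  rewrite /dlinks /= fK el; apply: (colourable_cons (at_root_member ia)) => //.
  apply: (@colourable_rcons _ _ _ _ _ m).
  - by move: mCij; rewrite !inE => /and3P[_ -> ->].
  - by have := wM m mM; rewrite eQ has_link_freeze.
  - apply: colourable_sub (hls m mM); apply/subsetP => k; rewrite !inE.
    by case/and4P=> -> _ -> ->.
rewrite negb_exists_in => /forall_inP/= allb.
have [m mM] : exists m, m \in M by apply/card_gt0P; apply: leq_ltn_trans sM.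
have mb : m \in at_root (f a) by rewrite -[_ \in _]negbK allb.
have bS : f a \in S by rewrite S_closed.
have [B [y' hB]] := tail_form_ex bS; have [yx' fy' _ _ /(_ m mb)[sD e]] := hB.
have wS : f w \in f h :: s by rewrite -mem_map_inv // /w /= fK mem_last.
have fw : f w != w by apply: (valid_active fK vs); rewrite /touch wS orbT.
have gw : g w != w.
  rewrite /g freeze_notin //; rewrite -S_closed; exact: vS.
have /andP[aD _] := contrQ (at_root_member mb).
have hxw : has_link g (Q' m) (x, w) by rewrite -has_linkC; apply: wM.
have [s' [y'' sB]] := root_link gK aD (g_root fx) gw hxw.
have eB : w :: s' = B.
  have xy' : x != y' by rewrite eq_sym.
  by rewrite e (same_sym gK) in sB; have [] := same_from xy' sB.
(* Here the link from [w] to [x] is the image of a link from [w] to [a]. The path is led through the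
   triangle: colour [m] from [w] to [a], then the matching edge, then colour [j] from [f a] to
   [x]. *)
case: (free (D := (y, f h :: rcons s a, x))).
  rewrite /aap /= fy fx !eqxx yx -rcons_cons valid_rcons // valid_cons //.
  by rewrite S_active //= vs andbT; apply/touch_pairPn; rewrite -(S_pair aS).
rewrite /dlinks /= fK links_rcons er; have mCij := MC m mM.
apply: (colourable_cons (at_root_member ia)) => //.
apply: (@colourable_rcons _ _ _ _ _ j).
- by rewrite !inE ji.
- by rewrite -has_linkC; apply: (tail_link hB jb); rewrite /= inE eqxx.
apply: (@colourable_rcons _ _ _ _ _ m); first by move: mCij; rewrite !inE.
- rewrite -has_linkC; apply: (tail_link hB mb).
  by rewrite -eB /= fK !inE eqxx orbT.
- exact: hls.
Qed.

(** Otherwise there is one colour too many. The class of [A] in the contracted badge has as many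
    members as [A] has nodes, and the dropped [i] agrees with it beyond the first node. With [m]
    colouring the first link of [A], and [j] the link from [x] to [f a] if [m] passes there, a path
    from [x] to [y] becomes rainbow. *)
Lemma at_root_class a A y m : a \in S -> tail_form a A y -> A != [::] -> m \in C ->
  same g (x, A, y) (Q' m) -> m \in at_root a.
Proof.
case: A => [|h A] // aS hA _ mC sm; have [i ia] := at_root_ex aS.
have [l la li] := at_root_two aS hA isT ia.
have [yx fy vA AS eA] := hA; have [_ Qi] := eA i ia; have [_ Ql] := eA l la.
have bS : f a \in S by rewrite S_closed.
apply/negPn/negP => ma.
have [j jb [jm]] : exists2 j, j \in at_root (f a) & j != m /\ true.
  case: (boolP (m \in at_root (f a))) => [mb|mb]; last first.
    have [j jb] := at_root_ex bS; exists j => //; split=> //.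
    by apply: contraNneq mb => <-.
  have [B [y' hB]] := tail_form_ex bS; have [_ _ _ _ /(_ m mb)[_ e]] := hB.
  have xy : x != y by rewrite eq_sym.
  have [eB _] : B = h :: A /\ y' = y by rewrite e in sm; have := same_from xy sm.
  by have [|j jb jm] := at_root_two bS hB _ mb; [rewrite eB|exists j].
have ji : j != i by apply: contraTneq jb => ->; apply: at_root_disjoint.
have jl : j != l by apply: contraTneq jb => ->; apply: at_root_disjoint.
have mi : m != i by apply: contraNneq ma => ->.
have bQ := contracts_badge aS ia jb contrQ.
have lC' : l \in C :\ i :\ j by rewrite !inE li (eq_sym l) jl (at_root_member la).
have := badge_mult bQ lC'; rewrite Ql /=; set M0 := [set _ in _ | _] => cM0.
have mM0 : m \in M0 by rewrite !inE (eq_sym m) jm mi mC.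
have xA : x \notin h :: A.
  by move: (valid_notin fK vA fx); rewrite inE negb_or => /andP[].
have restM0 k : k \in M0 -> all (has_link f (Q k)) (links f (f h) A y).
  rewrite !inE => /andP[/and3P[_ _ kC] sk]; apply/allP => e he.
  have [h1 h2] := linksP he; apply: (contracts_link_out (contrQ kC)).
  - rewrite -(same_link gK sk); apply/orP; left.
    have -> : links g x (h :: A) y = links f x (h :: A) y by rewrite /g links_freeze.
    by rewrite inE he orbT.
  - by apply: contraTneq h1 => ->; rewrite -map_cons mem_map_inv // fx.
  - apply: contraTneq h2 => ->; rewrite mem_rcons inE negb_or eq_sym yx.
    by move: xA; rewrite inE negb_or => /andP[].
have resti : all (has_link f (Q i)) (links f (f h) A y).
  by apply/allP => e he; apply: (tail_link hA ia); rewrite /= !inE he !orbT.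
have iM0 : i \notin M0 by rewrite !inE eqxx andbF.
have hrest : colourable f Q (i |: (M0 :\ m)) (links f (f h) A y).
  apply: colourable_all => [k|].
    by rewrite !inE => /orP[/eqP->//|/andP[_ kM]]; apply: restM0; rewrite !inE.
  rewrite cardsU1 in_setD1 (negPf iM0) andbF add1n size_links.
  by move: cM0; rewrite (cardsD1 m) mM0 add1n => -[->].
have sub : i |: (M0 :\ m) \subset C :\ j :\ m.
  apply/subsetP => k; rewrite !inE => /orP[/eqP->|/and3P[-> /and3P[-> _ ->] _]] //.
  by rewrite (eq_sym i) mi (eq_sym i) ji (at_root_member ia).
case: (boolP (m \in at_root (f a))) => mb.
  have [B [y' hB]] := tail_form_ex bS; have [_ _ _ _ /(_ m mb)[_ e]] := hB.
  have xy : x != y by rewrite eq_sym.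
  have [eB ey] : B = h :: A /\ y' = y by rewrite e in sm; have := same_from xy sm.
  rewrite eB ey in hB; have [_ _ vb _ _] := hB.
  case: (free (D := (x, f a :: h :: A, y))).
    by rewrite /aap /= fx fy !eqxx xy.
  rewrite /dlinks /=; apply: (colourable_cons (at_root_member jb)).
    by apply: (tail_link hB jb); rewrite /= inE eqxx.
  apply: (colourable_cons (i := m)); first by rewrite !inE (eq_sym m) jm.
    by apply: (tail_link hB mb); rewrite /= !inE eqxx orbT.
  exact: colourable_sub hrest.
have [untch eQ] := cut_untouched aS mC ma mb.
case: (free (D := (x, h :: A, y))).
  rewrite /aap /= fx fy !eqxx eq_sym yx.
  by move: vA; rewrite valid_cons // => /and3P[].
rewrite /dlinks /=; apply: (colourable_cons mC).
  rewrite -has_link_freeze // -eQ -(same_link gK sm); apply/orP; left.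
  by rewrite /= inE eqxx.
apply: colourable_sub hrest; apply: subset_trans sub _.
by apply/subsetP => k; rewrite !inE => /and3P[-> _ ->].
Qed.

(** Apart from the dropped [i], the members starting at [x], [a] are exactly the class of [A] in the
    contracted badge. The additional copy [i] matches the additional node [a]. *)
Lemma at_root_card a A y : a \in S -> tail_form a A y -> #|at_root a| = (size A).+1.
Proof.
move=> aS hA; have [i ia] := at_root_ex aS; have [j jb ji] := other_member aS ia.
have bQ := contracts_badge aS ia jb contrQ.
have [yx fy vA AS eA] := hA.
have at_root_member' l : l \in at_root a -> l != i -> l \in C :\ i :\ j.
  move=> la li; rewrite !inE li (at_root_member la) !andbT.
  by apply: contraTneq la => ->; rewrite -(fK a); apply: at_root_disjoint; rewrite ?S_closed.
rewrite (cardsD1 i) ia add1n; congr _.+1.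
case: (set_0Vmem (at_root a :\ i)) => [e0|[l]].
  case: (eqVneq A [::]) => [->|A0]; first by rewrite e0 cards0.
  have [l la li] := at_root_two aS hA A0 ia.
  by have := in_set0 l; rewrite -e0 in_setD1 li la.
rewrite in_setD1 => /andP[li la]; have lC' := at_root_member' l la li.
have [_ Ql] := eA l la.
have := badge_mult bQ lC'; rewrite Ql /= => cl; have A0 : A != [::].
  apply/eqP => A0; move/eqP: cl; rewrite A0 cards_eq0 => /eqP e.
  by have := in_set0 l; rewrite -e in_set lC' /= Ql A0 same_refl.
rewrite -cl; apply: eq_card => k; rewrite in_set in_setD1.
apply/andP/andP => [[ki ka]|[kC sk]].
  by have [_ ->] := eA k ka; rewrite same_refl at_root_member'.
have kC' : k \in C by move: kC; rewrite !inE => /and3P[].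
split; last exact: at_root_class sk.
by move: kC; rewrite !inE => /and3P[].
Qed.

(** In the contracted badge [A] has a partner [m], and the claim is that [m] passes [f a]. If [m]
    avoids the triangle, it has the link from [x] to [f h], where [h] is the first node of [A];
    colour [i] leads from [h] to [f a], and the members at [f a] colour the way along [B]. This is
    rainbow unless [B] meets [h], and then [badge_sep] identifies [B]. *)
Lemma partner_aux a A yA B yB : a \in S -> tail_form a A yA -> tail_form (f a) B yB ->
  A != [::] -> B = map f A /\ yB = yA.
Proof.
move=> aS hA hB A0; have [i ia] := at_root_ex aS.
have [l la li] := at_root_two aS hA A0 ia; have [j jb ji] := other_member aS ia.
have bS : f a \in S by rewrite S_closed.
have [yAx fyA vA AS eA] := hA; have [yBx fyB vB BS eB] := hB.
have xyA : x != yA by rewrite eq_sym.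
have bQ := contracts_badge aS ia jb contrQ.
have lj : l != j by apply: contraTneq jb => <-; apply: at_root_disjoint.
have lC' : l \in C :\ i :\ j by rewrite !inE li lj (at_root_member la).
have [_ Ql] := eA l la.
have egA : map g A = map f A by apply/eq_in_map => v vA'; rewrite /g freeze_notin ?AS.
have [m mC' sm] := badge_bar bQ lC'; rewrite Ql /bar /= egA in sm.
have mC : m \in C by move: mC'; rewrite !inE => /and3P[].
have [mb|mb] := boolP (m \in at_root (f a)).
  by have [_ e] := eB m mb; rewrite e in sm; have [] := same_from xyA sm.
have [ma|ma] := boolP (m \in at_root a).
  have [_ e] := eA m ma; rewrite e -egA in sm.
  have /andP[/and4P[_ _ _ vgA] _] := contrQ mC; rewrite e /= in vgA.
  have := bar_not_same gK (D := (x, A, yA)) xyA vgA.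
  by rewrite /bar /= sm lt0n size_eq0 => /(_ A0).
have [untch eQ] := cut_untouched aS mC ma mb.
case: A A0 hA vA AS eA sm Ql egA => // h A A0 hA vA AS eA sm Ql egA.
have hS : h \notin S by rewrite AS ?mem_head.
have [tB|tB] := boolP (touch f B h).
  have B0 : B != [::] by case: (B) tB.
  have [k kb kj] := at_root_two bS hB B0 jb.
  have ki : k != i by apply: contraTneq kb => ->; apply: at_root_disjoint.
  have kC' : k \in C :\ i :\ j by rewrite !inE kj ki (at_root_member kb).
  have [_ Qk] := eB k kb.
  have := badge_sep (v := h) bQ lC' kC'; rewrite Ql Qk /touches /bar [_.1.2]/= egA.
  have gh : g h = f h by rewrite /g freeze_notin.
  rewrite {1}/touch mem_head /touch gh => /(_ isT tB)/orP[sk|/(same_from xyA)//].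
  have ka : k \in at_root a by apply: (at_root_class aS hA) (at_root_member kb) _; rewrite // Qk.
  by have := at_root_disjoint aS ka; rewrite kb.
case: (free (D := (x, f h :: f a :: B, yB))).
  rewrite /aap /= fx fyB !eqxx eq_sym yBx valid_cons // vB fK eq_sym.
  have hv : f h != h by rewrite (valid_active fK vA) // /touch !inE eqxx orbT.
  rewrite hv touchf // /= andbT -cat1s touch_cat // (negPf tB) orbF.
  by apply: contra hS => /orP[]; rewrite !inE => /eqP e; rewrite ?e // -S_closed e.
rewrite /dlinks /= !fK; apply: (colourable_cons mC).
  rewrite -has_link_freeze // -eQ -(same_link gK sm); apply/orP; left.
  by rewrite /= inE eqxx.
have im : i != m by apply: contraNneq ma => <-.
apply: (colourable_cons (i := i)); first by rewrite !inE im (at_root_member ia).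
  by rewrite -has_linkC; apply: (tail_link hA ia); rewrite /= !inE eqxx orbT.
apply: (@colourable_sub _ _ _ _ (at_root (f a))).
  apply/subsetP => k kb; rewrite !inE (at_root_member kb) andbT; apply/andP; split.
    by apply: contraTneq kb => ->; apply: at_root_disjoint.
  by apply: contraNneq mb => <-.
apply: colourable_all; last by rewrite size_links (at_root_card bS hB).
move=> k kb; apply/allP => e he; apply: (tail_link hB kb).
by rewrite /= fK inE he orbT.
Qed.

Lemma tail_form_fK a A y : tail_form a A y -> tail_form (f (f a)) A y.
Proof. by rewrite fK. Qed.

Lemma partner a A yA B yB : a \in S -> tail_form a A yA -> tail_form (f a) B yB ->
  B = map f A /\ yB = yA.
Proof.
move=> aS hA hB; have bS : f a \in S by rewrite S_closed.
have [A0|] := eqVneq A [::]; last exact: (partner_aux aS hA hB).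
have [B0|B0] := eqVneq B [::]; last first.
  have [e _] := partner_aux bS hB (tail_form_fK hA) B0.
  by case: B B0 e {hB}; rewrite A0.
rewrite A0 B0; split=> //; apply/eqP/negPn/negP => yAB.
rewrite A0 in hA; rewrite B0 in hB.
have [i ia] := at_root_ex aS; have [j jb ji] := other_member aS ia.
have [yAx fyA vA AS eA] := hA; have [yBx fyB vB BS eB] := hB.
(* Without further nodes only the far ends can differ, and then the last links of [i] and [j] join
   them across the edge [f a], [a]. *)
case: (free (D := (yA, [:: f a], yB))); first by rewrite /aap /= fyA fyB !eqxx eq_sym yAB.
rewrite /dlinks /= fK; apply: (colourable_cons (at_root_member ia)).
  by rewrite -has_linkC; apply: (tail_link hA ia); rewrite /= !inE eqxx orbT.
apply: (colourable1 (i := j)); first by rewrite !inE ji (at_root_member jb).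
by apply: (tail_link hB jb); rewrite /= fK !inE eqxx orbT.
Qed.

Lemma same_freeze D D' : {in D.1.2, forall v, v \notin S} -> same g D D' = same f D D'.
Proof.
move=> h; rewrite /same /flip.
by have -> : map g D.1.2 = map f D.1.2 by apply/eq_in_map => v /h vS; rewrite /g freeze_notin.
Qed.

Lemma bar_freeze D : {in D.1.2, forall v, v \notin S} -> bar g D = bar f D.
Proof.
move=> h; rewrite /bar.
by have -> : map g D.1.2 = map f D.1.2 by apply/eq_in_map => v /h vS; rewrite /g freeze_notin.
Qed.

Lemma touches_freeze D v : v \notin S -> touches g D v = touches f D v.
Proof. by move=> vS; rewrite /touches /touch /g freeze_notin. Qed.

(** Each strip avoiding the triangle is inherited from the contracted badge, where [g] and [f] agree
    on its vertices. Each class through the triangle gains one node and, with [i] or [j], one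
    copy. *)
Lemma triangle_badge a : a \in S -> badge f Q C.
Proof.
move=> aS; have bS : f a \in S by rewrite S_closed.
have [i ia] := at_root_ex aS; have [j jb ji] := other_member aS ia.
have [A [y hA]] := tail_form_ex aS; have [B [yB hB]] := tail_form_ex bS.
have [eB ey] := partner aS hA hB; rewrite {B}eB {yB}ey in hB.
have [yx fy vA AS eA] := hA; have [_ _ vB BS eBb] := hB.
have xy : x != y by rewrite eq_sym.
have bQ := contracts_badge aS ia jb contrQ; set C' := C :\ i :\ j in bQ.
have C'C m : m \in C' -> m \in C by rewrite !inE => /and3P[].
have typ m : m \in C -> [\/ m \in at_root a, m \in at_root (f a) |
    [/\ m \notin at_root a, m \notin at_root (f a), m \in C',
        {in (Q m).1.2, forall v, v \notin S} & Q' m = Q m]].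
  move=> mC; case: (boolP (m \in at_root a)) => ma; first by constructor 1.
  case: (boolP (m \in at_root (f a))) => mb; first by constructor 2.
  have [h e] := cut_untouched aS mC ma mb; constructor 3; split=> //.
  rewrite !inE mC andbT; apply/andP; split.
    by apply: contraNneq mb => ->.
  by apply: contraNneq ma => ->.
have barab : bar f (x, a :: A, y) = (x, f a :: map f A, y) by [].
have barba : bar f (x, f a :: map f A, y) = (x, a :: A, y).
  by rewrite -barab barK.
have hbar' : bar g (x, A, y) = (x, map f A, y) by rewrite bar_freeze.
have hbar : bar g (x, map f A, y) = (x, A, y) by rewrite -hbar' (barK gK).
have nonnil m : m \in C' -> (Q' m).1.2 != [::].
  move=> mC; rewrite -size_eq0 -(badge_mult bQ mC) cards_eq0; apply/set0Pn; exists m.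
  by rewrite in_set mC same_refl.
(* The strips of members avoiding the triangle stay disjoint from the extended strip. *)
have sepA m : m \in C' -> same g (Q' m) (x, A, y) -> m \in at_root a.
  move=> mC sm; rewrite (same_sym gK) in sm; apply: (at_root_class aS hA _ (C'C m mC) sm).
  by have := nonnil m mC; rewrite -!size_eq0 -(same_size sm).
have sepB m : m \in C' -> same g (Q' m) (x, map f A, y) -> m \in at_root (f a).
  move=> mC sm; rewrite (same_sym gK) in sm; apply: (at_root_class bS hB _ (C'C m mC) sm).
  by have := nonnil m mC; rewrite -!size_eq0 -(same_size sm).
have untA m : {in (Q m).1.2, forall v, v \notin S} -> ~~ same f (Q m) (x, a :: A, y).
  move=> h; apply/negP => sm; have /(untouchedP _ aS) := h.
  by rewrite (same_touches fK sm) /touches /touch mem_head.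
have untB m : {in (Q m).1.2, forall v, v \notin S} -> ~~ same f (Q m) (x, f a :: map f A, y).
  move=> h; apply/negP => sm; have /(untouchedP _ aS) := h.
  by rewrite (same_touches fK sm) /touches /touch mem_head orbT.
split.
- move=> v fv; case: (boolP (v \in S)) => vS.
    exists i; first exact: at_root_member ia.
    have [sD _] := eA i ia; rewrite -(same_touches fK sD) /touches /touch !inE.
    by case: (S_pairE aS vS) => ->; rewrite ?fK eqxx ?orbT.
  have [|m mC tm] := badge_cover bQ (v := v); first by rewrite /g freeze_notin.
  rewrite touches_freeze // in tm; exists m; first exact: C'C.
  case: (typ m (C'C m mC)) => [ma|mb|[_ _ _ _ <-//]].
    have [sD e] := eA m ma; rewrite -(same_touches fK sD); rewrite e in tm.
    by rewrite /touches /= -cat1s touch_cat // [X in _ || X]tm orbT.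
  have [sD e] := eBb m mb; rewrite -(same_touches fK sD); rewrite e in tm.
  by rewrite /touches /= -cat1s touch_cat // [X in _ || X]tm orbT.
- move=> m mC; case: (typ m mC) => [ma|mb|[ma mb mC' h e]].
  + exists j; first exact: at_root_member jb.
    have [sD _] := eA m ma; have [sE _] := eBb j jb.
    by apply: same_trans sE; rewrite // -barab same_bar // same_sym.
  + exists i; first exact: at_root_member ia.
    have [sD _] := eBb m mb; have [sE _] := eA i ia.
    by apply: same_trans sE; rewrite // -barba same_bar // same_sym.
  have [k kC sk] := badge_bar bQ mC'; exists k; first exact: C'C.
  rewrite e in sk; case: (typ k (C'C k kC)) => [ka|kb|[_ _ _ hk ek]].
  + have [_ ek] := eA k ka; case/negP: mb; apply: sepB => //.
    by rewrite ek -hbar same_bar // in sk; rewrite e.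
  + have [_ ek] := eBb k kb; case/negP: ma; apply: sepA => //.
    by rewrite ek -hbar' same_bar // in sk; rewrite e.
  rewrite ek bar_freeze // same_freeze // in sk => v.
  by rewrite /= mem_map_inv // => /h; rewrite S_closed.
- move=> m mC; case: (typ m mC) => [ma|mb|[ma mb mC' h e]].
  + have [sD _] := eA m ma; rewrite -(same_size sD) /= -(at_root_card aS hA).
    apply: eq_card => k; rewrite in_set; apply/andP/idP => [[kC sk]|ka].
      exact: same_at_root kC (same_trans fK sD sk).
    split; first exact: at_root_member ka.
    by have [sE _] := eA k ka; apply: same_trans sE; rewrite // same_sym.
  + have [sD _] := eBb m mb; rewrite -(same_size sD) /= -(at_root_card bS hB).
    apply: eq_card => k; rewrite in_set; apply/andP/idP => [[kC sk]|ka].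
      exact: same_at_root kC (same_trans fK sD sk).
    split; first exact: at_root_member ka.
    by have [sE _] := eBb k ka; apply: same_trans sE; rewrite // same_sym.
  have := badge_mult bQ mC'; rewrite e => <-; apply: eq_card => k.
  rewrite in_set in_set; apply/andP/andP => -[kC sk].
    case: (typ k kC) => [ka|kb|[_ _ kC' hk ek]].
    * by have [sE _] := eA k ka; case/negP: (untA m h);
        apply: same_trans sk _; rewrite // same_sym.
    * by have [sE _] := eBb k kb; case/negP: (untB m h);
        apply: same_trans sk _; rewrite // same_sym.
    by split=> //; rewrite ek same_freeze.
  have kC' := C'C k kC; split=> //; case: (typ k kC') => [ka|kb|[_ _ _ hk ek]].
  * by have [_ ek] := eA k ka; case/negP: ma; apply: sepA; rewrite // e -ek.
  * by have [_ ek] := eBb k kb; case/negP: mb; apply: sepB; rewrite // e -ek.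
  by rewrite ek same_freeze in sk.
(* If [A] has a node, a member other than [i] starts at [x], [a]. It survives in the contracted
   badge, so [badge_sep] there speaks about [A]. *)
have rep v : touch f A v -> exists2 m, m \in C' & Q' m = (x, A, y).
  move=> tA; have A0 : A != [::] by case: (A) tA.
  have [m ma mi] := at_root_two aS hA A0 ia; exists m; last by case: (eA m ma).
  rewrite !inE mi (at_root_member ma) !andbT.
  by apply: contraTneq ma => ->; rewrite -(fK a); apply: at_root_disjoint.
have noAU k v : v \notin S -> k \in C' -> k \notin at_root a -> k \notin at_root (f a) ->
    Q' k = Q k -> touches f (Q k) v -> ~~ touch f A v.
  move=> vS kC ka kb ek tk; apply/negP => tA; have [m mC em] := rep v tA.
  have := badge_sep (v := v) bQ mC kC.
  rewrite !touches_freeze // em ek hbar' => /(_ tA tk)/orP[]; rewrite (same_sym gK) -ek.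
    by move/(sepA k kC); rewrite (negPf ka).
  by move/(sepB k kC); rewrite (negPf kb).
have out v m : m \in C -> v \notin S -> touches f (Q m) v ->
    (m \in at_root a) || (m \in at_root (f a)) -> touch f A v.
  move=> mC vS tm; have va : ~~ touch f [:: a] v.
    apply/negP => /orP[]; rewrite inE => /eqP e; case/negP: vS.
      by rewrite e.
    by rewrite -S_closed e.
  have vb : ~~ touch f [:: f a] v.
    by rewrite -[[:: f a]]/(map f [:: a]) touch_map.
  case/orP=> h; [have [sD _] := eA m h|have [sD _] := eBb m h];
    move: tm; rewrite -(same_touches fK sD) /touches /= -cat1s touch_cat //.
    by rewrite (negPf va).
  by rewrite (negPf vb) touch_map.
move=> m k v mC kC tm tk.
have AB m' k' : m' \in at_root a -> k' \in at_root (f a) -> same f (bar f (Q m')) (Q k').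
  move=> ma kb; have [sD _] := eA m' ma; have [sE _] := eBb k' kb.
  by apply: same_trans sE; rewrite // -barab same_bar // same_sym.
have AA m' k' b D : same f D (Q m') -> same f D (Q k') -> same f (Q m') (Q k') || b.
  by move=> h1 h2; rewrite (same_trans fK _ h2) // same_sym.
have unt k' : k' \in C -> touches f (Q k') v -> k' \notin at_root a -> k' \notin at_root (f a) ->
    v \notin S.
  move=> kC' tk' ka kb; apply: contraL tk' => vS.
  by have [h _] := cut_untouched aS kC' ka kb; apply/(untouchedP _ vS).
(* Two members at the triangle lie in the extended strip, and a member at the triangle meets none
   avoiding it; two members avoiding it are compared in the contracted badge. *)
case: (typ m mC) => [ma|mb|[ma mb mC' h e]]; case: (typ k kC) => [ka|kb|[ka kb kC' h' e']].
- by have [sD _] := eA m ma; have [sE _] := eA k ka; apply: AA sD sE.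
- by rewrite AB ?orbT.
- have vS := unt k kC tk ka kb; have := noAU k v vS kC' ka kb e' tk.
  by rewrite (out v m) // ma.
- apply/orP; right; rewrite -(same_bar fK) barK // same_sym //; exact: AB.
- by have [sD _] := eBb m mb; have [sE _] := eBb k kb; apply: AA sD sE.
- have vS := unt k kC tk ka kb; have := noAU k v vS kC' ka kb e' tk.
  by rewrite (out v m) // mb orbT.
- have vS := unt m mC tm ma mb; have := noAU m v vS mC' ma mb e tm.
  by rewrite (out v k) // ka.
- have vS := unt m mC tm ma mb; have := noAU m v vS mC' ma mb e tm.
  by rewrite (out v k) // kb orbT.
have vS := unt m mC tm ma mb; have := badge_sep (v := v) bQ mC' kC'.
rewrite e e' !touches_freeze // => /(_ tm tk); rewrite bar_freeze // !same_freeze //.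
by move=> w; rewrite /= mem_map_inv // => /h; rewrite S_closed.
Qed.

End Cut.
End ContractTriangle.

Theorem rainbow_free_badge (V I : finType) f (Q : I -> V * seq V * V) (C : {set I}) :
    involutive f -> {in C, forall i, aap f (Q i)} -> rainbow_free f Q C ->
    #|C| = #|[pred v | f v != v]| ->
  badge f Q C.
Proof.
move: {2}_.+1 (ltnSn #|C|) => N.
elim: N f Q C => // N IH f Q C ltN fK aQ free cC.
have [C0|C0] := posnP #|C|.
  have e0 := cC; rewrite C0 in e0; move/esym/card0_eq in e0.
  have {}C0 i : (i \in C) = false by rewrite (cards0_eq C0) inE.
  by split=> [v fv|i|i|i j v]; rewrite ?C0 //; have := e0 v; rewrite inE fv.
have [x [a [i [j [[fx fa iC jC ij] [hi hj]]]]]] := triangle fK aQ free cC C0.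
set S := [set a; f a].
have aS : a \in S by rewrite !inE eqxx.
have S_pair : {in S, forall c, S = [set c; f c]}.
  by move=> c; rewrite !inE => /orP[]/eqP-> //; rewrite fK setUC.
have S_act : {in S, forall c, f c != c} by exact: pair_active.
have S_link : {in S, forall c, exists2 i, i \in C & has_link f (Q i) (x, c)}.
  by move=> c; rewrite !inE => /orP[]/eqP->; [exists i|exists j].
have IH' g (Q' : I -> V * seq V * V) (C' : {set I}) : #|C'| < #|C| ->
    involutive g -> {in C', forall i, aap g (Q' i)} -> rainbow_free g Q' C' ->
    #|C'| = #|[pred v | g v != v]| -> badge g Q' C'.
  by move=> h; apply: IH; apply: leq_trans h _.
have [Q' hQ'] := cut_ex fK aQ free cC fx S_pair S_act S_link IH' aS.
exact: (triangle_badge fK aQ free cC fx S_pair S_act S_link IH' hQ' aS).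
Qed.

(** * Translation to and from edge sets *)

Section Mate.
Variables (V : finType) (G : sgraph V) (F : {set {set V}}).
Hypothesis matchF : matching G F.

Definition mate v := odflt v [pick w | ([set v; w] \in F) && (w != v)].

Lemma matching_edge e : e \in F -> exists u w, [/\ u != w, e = [set u; w] & G u w].
Proof.
case/andP: matchF => /subsetP h _ /h /imsetP[[u w] /= Guw ->].
exists u, w; split=> //; apply: contraTneq Guw => /= ->.
by rewrite inE /= adj_irrefl.
Qed.

Lemma mateP v : mate v != v -> [set v; mate v] \in F.
Proof. by rewrite /mate; case: pickP => [w /andP[]|_] //=; rewrite eqxx. Qed.

Lemma set2_inj (u w w' : V) : u != w -> [set u; w] = [set u; w'] -> w = w'.
Proof.
by move=> uw /setP/(_ w); rewrite !inE eqxx orbT eq_sym (negPf uw) => /esym/eqP.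
Qed.

Lemma mate_edge u w : [set u; w] \in F -> mate u = w.
Proof.
move=> uF; have [a [b [ab e _]]] := matching_edge uF.
have uw : u != w.
  apply: contraNneq ab => uw; move: e; rewrite uw setUid => /setP e.
  have := e a; have := e b; rewrite !inE !eqxx orbT /= => /eqP-> /eqP->.
  by [].
rewrite /mate; case: pickP => [w' /andP[wF w'u]|/(_ w)] /=; last first.
  by rewrite uF eq_sym uw.
apply/esym/(set2_inj uw)/eqP; case/andP: matchF => _ /trivIsetP tF.
apply: contraT => ne; have := tF _ _ uF wF ne.
by move/disjoint_setI0/setP/(_ u); rewrite !inE eqxx.
Qed.

Lemma mateK : involutive mate.
Proof.
move=> v; have [e|/mateP h] := eqVneq (mate v) v; first by rewrite !e.
by apply: mate_edge; rewrite setUC.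
Qed.

Lemma mem_cover v : (v \in cover F) = (mate v != v).
Proof.
apply/bigcupP/idP => [[e eF ve]|/mateP h]; last by exists [set v; mate v]; rewrite // !inE eqxx.
have [u [w [uw E _]]] := matching_edge eF; rewrite E !inE in ve eF.
case/orP: ve => /eqP->; first by rewrite (mate_edge eF) eq_sym.
by rewrite (@mate_edge w u) // setUC.
Qed.

Lemma card_active : #|[pred v | mate v != v]| = 2 * #|F|.
Proof.
have -> : #|[pred v | mate v != v]| = #|cover F|.
  by apply: eq_card => v; rewrite mem_cover.
case/andP: matchF => _ /eqP <-.
rewrite mulnC -sum_nat_const; apply: eq_bigr => e /matching_edge[u [w [uw -> _]]].
by rewrite cards2 uw.
Qed.

Definition edge (l : V * V) : {set V} := [set l.1; l.2].

Lemma edge_swap l : edge (swap l) = edge l.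
Proof. by rewrite /edge setUC. Qed.

Definition edge_set (D : V * seq V * V) : {set {set V}} :=
  [set:: map edge (dlinks mate D) ++ [seq edge (c, mate c) | c <- D.1.2]].

Definition proper_links D := all (fun l => G l.1 l.2) (dlinks mate D).

(** The condition on the mate of the start makes the induction pass: there the start is [mate c],
    and its mate [c] is a vertex already left behind. *)
Lemma links_not_mate cs a q : valid mate cs -> mate q = q -> mate a \notin rcons cs q ->
  {in links mate a cs q, forall l, mate l.1 != l.2}.
Proof.
elim: cs a => [|c s IH] a /=.
  by move=> _ fq; rewrite inE => h l; rewrite inE => /eqP->.
rewrite valid_cons //; last exact: mateK.
case/and3P=> mc /norP[tc _] vs mq; rewrite inE negb_or => /andP[ac _] l.
rewrite inE => /orP[/eqP-> //|]; apply: IH => //.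
rewrite mateK mem_rcons inE negb_or tc andbT.
by apply: contraNneq mc => ->; rewrite mq.
Qed.

Lemma links_notin_F D : aap mate D -> {in dlinks mate D, forall l, edge l \notin F}.
Proof.
case/and4P=> /eqP fp /eqP fq pq hv l hl; apply/negP => /mate_edge e.
have h : mate D.1.1 \notin rcons D.1.2 D.2.
  by rewrite fp mem_rcons inE negb_or pq (valid_notin mateK hv fp).
by have := links_not_mate hv fq h hl; rewrite e eqxx.
Qed.

Lemma edge_set_diff D : aap mate D -> edge_set D :\: F = [set:: map edge (dlinks mate D)].
Proof.
move=> aD; apply/setP => e; rewrite !inE mem_cat andb_orr.
have -> : (e \notin F) && (e \in [seq edge (c, mate c) | c <- D.1.2]) = false.
  apply/negP => /andP[eF /mapP[c cD ee]]; case/negP: eF; rewrite ee; apply: mateP.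
  have /and4P[_ _ _ hv] := aD; apply: (valid_active mateK hv).
  by rewrite /touch cD.
by rewrite orbF; apply: andb_idl => /mapP[l hl ->]; apply: links_notin_F hl.
Qed.

Lemma edge_set_flip D : edge_set (flip mate D) = edge_set D.
Proof.
apply/setP => e; rewrite !inE !mem_cat; congr orb.
  rewrite /dlinks links_rev ?map_rev ?mem_rev; last exact: mateK.
  by rewrite -map_comp (eq_map edge_swap).
rewrite map_rev mem_rev -map_comp; congr (_ \in _); apply: eq_map => c /=.
by rewrite mateK -[RHS]edge_swap.
Qed.

Lemma same_edge_set D D' : same mate D D' -> edge_set D = edge_set D'.
Proof. by case/orP=> /eqP->; rewrite ?edge_set_flip. Qed.

Fixpoint walk (cs : seq V) q := if cs is c :: s then [:: c, mate c & walk s q] else [:: q].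

Lemma perm_walk cs q : perm_eq (walk cs q) (q :: (cs ++ map mate cs)).
Proof.
elim: cs => //= c s IH; apply/permP => P; have /= -> := permP IH P.
rewrite !count_cat /= [RHS]addnCA; congr addn.
by rewrite [in RHS](addnCA _ (P (mate c))) [RHS]addnCA.
Qed.

Lemma last_walk a cs q : last a (walk cs q) = q.
Proof. by elim: cs a => /=. Qed.

Lemma walk_edges_walk a cs q : walk_edges a (walk cs q) =i
  map edge (links mate a cs q) ++ [seq edge (c, mate c) | c <- cs].
Proof.
elim: cs a => [|c s IH] a e; first by rewrite /= !inE.
rewrite /= !inE -/(walk_edges (mate c) (walk s q)) IH !mem_cat !inE.
by congr orb; rewrite orbCA.
Qed.

Lemma walk_is_aap D : aap mate D -> proper_links D -> is_aap G F (edge_set D).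
Proof.
case: D => [[p cs] q] aD pD; exists p, (walk cs q).
have /and4P[/= /eqP fp /eqP fq pq hv] := aD.
have act c : c \in cs -> mate c != c.
  by move=> h; apply: (valid_active mateK hv); rewrite /touch h.
split.
- by case: (cs).
- apply/andP; split; last first.
    rewrite /= (perm_uniq (perm_walk cs q)) (perm_mem (perm_walk cs q)) /= -/(valid _ _) hv.
    rewrite !inE !mem_cat !(mem_map_inv mateK) fp fq.
    by rewrite !(negPf (valid_notin mateK hv _)) // (negPf pq).
  move: pD act; rewrite /proper_links /dlinks /=; elim: (cs) (p) => [|c s IH] a /=.
    by rewrite !andbT.
  case/andP=> -> h act /=; rewrite IH //; last by move=> d ds; rewrite act // inE ds orbT.
  have /mateP/matching_edge[u [w [uw e Guw]]] := act c (mem_head _ _).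
  rewrite andbT; have : (u, w) = (c, mate c) \/ (u, w) = (mate c, c).
    have mc := act c (mem_head _ _).
    have : u \in [set c; mate c] by rewrite e !inE eqxx.
    rewrite !inE => /orP[]/eqP eu; rewrite eu in e *.
      by left; rewrite (set2_inj _ e) // eq_sym.
    right; congr pair; apply/esym; apply: (set2_inj mc).
    by rewrite setUC.
  by case=> -[<- <-] //; rewrite adj_sym.
- have nF : {in links mate p cs q, forall l, edge l \notin F} by apply: links_notin_F aD.
  rewrite /alternating; case: (cs) act nF => [|c s] //= act nF.
  have : {in links mate (mate c) s q, forall l, edge l \notin F} /\
         {in c :: s, forall d, edge (d, mate d) \in F}.
    split=> [l hl|d ds]; last exact/mateP/act.
    by apply: nF; rewrite inE hl orbT.
  have -> : ([set p; c] \in F) = false by apply/negbTE/(nF (p, c)); rewrite mem_head.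
  elim: s c {act nF} => [|d s IH] c [nF inF] /=.
    rewrite -[[set c; mate c]]/(edge (c, mate c)) inF ?mem_head //=.
    by rewrite (negPf (nF (mate c, q) _)) ?mem_head.
  rewrite -[[set c; mate c]]/(edge (c, mate c)) inF ?mem_head //=.
  rewrite -[[set mate c; d]]/(edge (mate c, d)) (negPf (nF (mate c, d) _)) ?mem_head //=.
  apply: IH; split=> [l hl|d' ds]; first by apply: nF; rewrite inE hl orbT.
  by apply: inF; rewrite inE ds orbT.
- by rewrite last_walk !mem_cover fp fq !eqxx.
- by apply/setP => e; rewrite !inE walk_edges_walk.
Qed.

Lemma aap_is_walk X : is_aap G F X -> exists D, [/\ aap mate D, proper_links D & X = edge_set D].
Proof.
case=> x [p [p0 /andP[pG up] alt /andP[xF yF] ->]].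
(* Two vertices are consumed at a time, hence the induction on a bound for the length. The condition
   on [mate (head a s)] says that the first edge is outside [F], so alternation puts the second one
   into [F]. *)
have key n a s : size s <= n -> s != [::] -> path G a s -> uniq (a :: s) ->
    alternating F a s -> mate (head a s) != a -> last a s \notin cover F ->
  exists cs q, [/\ s = walk cs q, mate q = q & all (fun l => G l.1 l.2) (links mate a cs q)].
  elim: n a s => [|n IH] a [|c s] //= sn _ /andP[Gac pG'] us alt' nm yF'.
  case: s sn pG' us alt' yF' => [|d s] sn pG' us alt' yF'.
    exists [::], c; rewrite /= Gac; split=> //.
    by apply/eqP; move: yF'; rewrite mem_cover negbK.
  have acF : [set a; c] \in F = false.
    by apply/negP; rewrite setUC => /mate_edge e; rewrite e eqxx in nm.
  move: alt'; rewrite /alternating /= acF => /andP[]; rewrite eq_sym eqbF_neg negbK => cdF alt'.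
  have ed := mate_edge cdF.
  have s0 : s != [::].
    apply: contraNneq (yF') => -> /=; rewrite mem_cover -ed mateK ed.
    by case/and3P: us => _; rewrite inE negb_or => /andP[].
  have [||||||cs [q [e fq hG]]] := IH d s _ s0.
  - exact: ltnW.
  - by case/andP: pG'.
  - by case/and3P: us.
  - by move: alt'; rewrite /alternating; case: (s) => //= h s1 /andP[].
  - case: (s) s0 alt' us => // h s1 _ /= /andP[+ _] /and4P[_ _ + _].
    rewrite cdF inE negb_or => hF /andP[dh _]; apply: contraNneq hF => e'.
    by rewrite -e' setUC mateP // e'.
  - exact: yF'.
  exists (c :: cs), q; rewrite /= ed -e Gac hG; split=> //.
have [|cs [q [e fq hG]]] := key (size p) x p (leqnn _) p0 pG up alt _ yF.
  case: (p) p0 up => // h s _ /= /andP[+ _]; rewrite inE negb_or => /andP[xh _].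
  apply: contraNneq xF => e; rewrite mem_cover; apply: contra xh => /eqP fx.
  by rewrite -fx -e mateK.
have fx : mate x = x by apply/eqP; move: xF; rewrite mem_cover negbK.
exists (x, cs, q); split=> //; last first.
  by apply/setP => l; rewrite e !inE walk_edges_walk.
move: up; rewrite e /= (perm_uniq (perm_walk cs q)) (perm_mem (perm_walk cs q)) /=.
rewrite !inE negb_or => /andP[/andP[xq _] /andP[_ hv]].
by rewrite /aap /= fx fq !eqxx xq.
Qed.

End Mate.

Section Rainbow.
Variables (V : finType) (G : sgraph V) (F : {set {set V}}) (P : seq {set {set V}}).
Hypothesis matchF : matching G F.
Variable Q : 'I_(size P) -> V * seq V * V.
Hypothesis aapQ : forall i, aap (mate F) (Q i).
Hypothesis properQ : forall i, proper_links G F (Q i).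
Hypothesis edgeQ : forall i : 'I_(size P), nth set0 P i = edge_set F (Q i).

Lemma colourable_rainbow D : aap (mate F) D ->
  colourable (mate F) Q [set: 'I_(size P)] (dlinks (mate F) D) ->
  rainbow_aap G F P (edge_set F D).
Proof.
move=> aD [s [us _ hs]]; split.
  apply: walk_is_aap => //; apply/allP => l hl.
  have : all2 (fun i l => has_link (mate F) (Q i) l) s (dlinks (mate F) D) := hs.
  elim: s (dlinks _ _) hl {us hs} => [|i s IH] [|l' ls] //= + /andP[hi hs].
  rewrite inE => /orP[/eqP->|/IH]; last exact.
  have /allP pQ := properQ i; case/orP: hi => /pQ //=.
  by rewrite adj_sym.
rewrite (edge_set_diff matchF) //; set ls := dlinks (mate F) D in hs *.
pose es := map (@edge V) ls.
(* An edge receives the colour listed at its first position; the default 0 is never reached on edges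
   of the path. *)
exists (fun e => nth 0 (map val s) (index e es)).
have zs : size s = size ls by move: hs; rewrite all2E => /andP[/eqP].
have ze : size (map val s) = size es by rewrite !size_map.
have us' : uniq (map val s) by rewrite map_inj_uniq //; apply: val_inj.
split=> [e e'|e]; rewrite !inE.
  move=> he he' /eqP; rewrite nth_uniq ?ze ?index_mem // => /eqP h.
  by rewrite -(nth_index set0 he) h nth_index.
move=> he; have hi : index e es < size ls by rewrite -(size_map (@edge V)) index_mem.
have /mapP[l0 _ _] := he.
have [i0 _] : exists i0, i0 \in s.
  by case: (s) zs hi => [<-|i0 s'] // _ _; exists i0; rewrite mem_head.
rewrite (nth_map i0) ?zs //.
have : has_link (mate F) (Q (nth i0 s (index e es))) (nth l0 ls (index e es)).
  move: hs; rewrite all2E => /andP[_ /allP h]; move: (h (nth (i0, l0) (zip s ls) (index e es))).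
  rewrite nth_zip //; apply; rewrite -nth_zip // mem_nth // size_zip zs minnn //.
have ee : edge (nth l0 ls (index e es)) = e.
  by rewrite -(nth_map _ set0) // nth_index.
move=> hl; split; first exact: ltn_ord.
rewrite edgeQ inE mem_cat; apply/orP; left; rewrite -[X in X \in _]ee; case/orP: hl => hl.
  exact: map_f.
by rewrite -edge_swap; apply: map_f.
Qed.

End Rainbow.

(** * Origamistrips as pairs of alternating paths *)

Lemma bigcup_natP (T : finType) (A : nat -> {set T}) m n (a : T) :
  reflect (exists2 i, m <= i < n & a \in A i) (a \in \bigcup_(m <= i < n) A i).
Proof.
have -> : (a \in \bigcup_(m <= i < n) A i) = has (fun i => a \in A i) (index_iota m n).
  by elim: (index_iota m n) => [|i r IH]; rewrite ?big_nil ?big_cons !inE ?IH.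
by apply: (iffP hasP) => -[i hi ai]; exists i => //; move: hi; rewrite mem_index_iota.
Qed.

Lemma map_nth_iota (T : Type) (x0 : T) s : map (fun t => nth x0 s t.-1) (iota 1 (size s)) = s.
Proof.
apply: (@eq_from_nth _ x0); first by rewrite size_map size_iota.
move=> t; rewrite size_map size_iota => ts.
by rewrite (nth_map 0) ?size_iota // nth_iota.
Qed.

(** The edges of A(OS) pair the sequence of [x] and the [v i] with that of the [u i] and [y].
    Exchanging [u] and [v] gives B(OS), so one statement serves both. *)
Lemma strip_linksE (V : finType) (u v : nat -> V) (x y : V) m : 0 < m ->
  [set:: map (@edge V) (zip (x :: map v (iota 1 m)) (rcons (map u (iota 1 m)) y))] =
  [set x; u 1] |: ([set v m; y] |: \bigcup_(1 <= i < m) [set [set v i; u i.+1]]).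
Proof.
move=> m0; apply/setP => e; rewrite inE; set L := zip _ _.
have zL : size L = m.+1.
  by rewrite size_zip size_rcons /= !size_map size_iota minnn.
have nL t : t <= m -> nth (x, x) L t =
    (if t == 0 then x else v t, if t == m then y else u t.+1).
  move=> tm; rewrite nth_zip ?size_rcons /= ?size_map //; congr pair.
    by case: t tm => //= t tm; rewrite (nth_map 0) ?size_iota // nth_iota.
  rewrite nth_rcons size_map size_iota; have [->|tm'] := eqVneq t m.
    by rewrite ltnn.
  have tm2 : t < m by rewrite ltn_neqAle tm' tm.
  by rewrite tm2 (nth_map 0) ?size_iota // nth_iota.
have inL t : t <= m -> edge (nth (x, x) L t) \in map (@edge V) L.
  by move=> tm; rewrite map_f // mem_nth // zL.
apply/mapP/setU1P => [[l /(nthP (x, x))[t]]|].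
  rewrite zL ltnS => tm <- ->; rewrite nL //; have [->|t0] := eqVneq t 0.
    by left; rewrite eq_sym (gtn_eqF m0).
  right; apply/setU1P; have [->|tm'] := eqVneq t m; first by left.
  right; apply/bigcup_natP; exists t; last by rewrite inE.
  by rewrite lt0n t0 ltn_neqAle tm' tm.
move=> h; apply/mapP; case: h => [->|/setU1P[->|/bigcup_natP[t /andP[t1 tm]]]].
- by have := inL 0 isT; rewrite nL //= eq_sym (gtn_eqF m0).
- by have := inL m (leqnn m); rewrite nL // (gtn_eqF m0) eqxx.
rewrite inE => /eqP->; have := inL t (ltnW tm).
by rewrite nL 1?ltnW // (gtn_eqF t1) (ltn_eqF tm).
Qed.

Lemma strip_skeletonE (V : finType) (u v : nat -> V) m :
  [set:: [seq [set u i; v i] | i <- iota 1 m]] = \bigcup_(1 <= i < m.+1) [set [set u i; v i]].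
Proof.
apply/setP => e; rewrite inE; apply/mapP/bigcup_natP => -[i].
  by rewrite mem_iota add1n => hi ->; exists i; rewrite ?inE.
by move=> hi; rewrite inE => /eqP->; exists i; rewrite // mem_iota add1n.
Qed.

Section Strip.
Variables (V : finType) (G : sgraph V) (F : {set {set V}}).
Hypothesis matchF : matching G F.
Let f := mate F.
Let fK : involutive f := mateK matchF.

Lemma links_zip p cs q : links f p cs q = zip (p :: map f cs) (rcons cs q).
Proof. by rewrite -(links_fst f p cs q) -(links_snd f p cs q) zip_unzip. Qed.

Lemma strip_of_dipath D : aap f D -> D.1.2 != [::] ->
  exists OS : origamistrip V, [/\ os_len OS = size D.1.2, os_x OS = D.1.1,
    os_y OS = D.2, os_interior OS = [set v | touches f D v] &
    os_PA OS = edge_set F D /\ os_PB OS = edge_set F (bar f D)].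
Proof.
case: D => [[p cs] q] /and4P[/= /eqP fp /eqP fq pq hv] cs0.
(* Strips are indexed from 1, hence the shift. The path enters its matching edges at the [u t], so
   it is P^A, and its [bar] is P^B. *)
pose u t := nth p cs t.-1; pose v t := f (u t).
have m0 : 0 < size cs by rewrite lt0n size_eq0.
have eu : map u (iota 1 (size cs)) = cs by apply: map_nth_iota.
have ev : map v (iota 1 (size cs)) = map f cs by rewrite -[in RHS]eu -map_comp.
have os_un : uniq (map u (iota 1 (size cs)) ++ map v (iota 1 (size cs)) ++ [:: p; q]).
  rewrite eu ev catA cat_uniq -/(valid _ _) hv /= orbF !mem_cat !mem_map_inv //.
  by rewrite fp fq !(negPf (valid_notin fK hv _)) // inE pq.
exists (OrigamiStrip m0 os_un); split=> //.
  by apply/setP => w; rewrite /os_interior /= eu ev !inE mem_cat mem_map_inv.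
rewrite /os_PA /os_PB /os_A /os_B /os_M /=.
rewrite -!strip_linksE // -strip_skeletonE eu ev; split; apply/setP => e; rewrite !inE mem_cat.
  by rewrite /dlinks /= links_zip; congr (_ || (_ \in _)); rewrite -[in RHS]eu -map_comp.
rewrite /dlinks /= links_zip mapK //; congr (_ || (_ \in _)).
rewrite -ev -map_comp; congr pred_of_seq; apply: eq_map => t.
by rewrite /edge /v /= -/f fK setUC.
Qed.

End Strip.

(** * The multigraph of a badge *)

Section BadgeFamily.
Variables (V : finType) (G : sgraph V) (F : {set {set V}}) (P : seq {set {set V}}).
Hypothesis matchF : matching G F.
Variable Q : 'I_(size P) -> V * seq V * V.
Let f := mate F.
Let fK : involutive f := mateK matchF.
Hypothesis aapQ : forall i, aap f (Q i).
Hypothesis edgeQ : forall i : 'I_(size P), nth set0 P i = edge_set F (Q i).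
Hypothesis badgeQ : badge f Q [set: 'I_(size P)].

Definition strip_rel i j := same f (Q i) (Q j) || same f (bar f (Q i)) (Q j).

(** The choice depends only on the predicate [strip_rel i] up to extensionality, so equivalent
    indices get the same representative. The representatives serve as edges of the multigraph. *)
Definition strip_repr i := odflt i [pick j | strip_rel i j].

Definition copies D := [set j in [set: 'I_(size P)] | same f D (Q j)].

Lemma strip_rel_refl i : strip_rel i i.
Proof. by rewrite /strip_rel same_refl. Qed.

Lemma strip_rel_left i j : strip_rel i j -> strip_rel j =1 strip_rel i.
Proof.
have aux D D' k : same f D D' -> same f D' k = same f D k.
  move=> h; apply/idP/idP => h'; first exact: same_trans h h'.
  by apply: same_trans h'; rewrite // same_sym.
rewrite /strip_rel => /orP[]h k; have h' := h; rewrite -same_bar // in h'.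
  by rewrite (aux _ _ _ h) (aux _ _ _ h').
by rewrite barK // in h'; rewrite (aux _ _ _ h) (aux _ _ _ h') orbC.
Qed.

Lemma strip_repr_rel i : strip_rel i (strip_repr i).
Proof. by rewrite /strip_repr; case: pickP => // /(_ i); rewrite strip_rel_refl. Qed.

Lemma strip_repr_eq i j : strip_rel i j -> strip_repr i = strip_repr j.
Proof.
move=> h; rewrite /strip_repr (eq_pick (strip_rel_left h)).
by case: pickP => // /(_ i); rewrite strip_rel_refl.
Qed.

Definition strip := {i : 'I_(size P) | strip_repr i == i}.

Lemma strip_of_proof i : strip_repr (strip_repr i) == strip_repr i.
Proof. by rewrite eq_sym; apply/eqP/strip_repr_eq/strip_repr_rel. Qed.

Definition strip_of i : strip := exist _ (strip_repr i) (strip_of_proof i).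

Lemma strip_ofP (e : strip) i : strip_rel (val e) i = (e == strip_of i).
Proof.
apply/idP/eqP => [h|->].
  by apply: val_inj; rewrite /= -(strip_repr_eq h) (eqP (valP e)).
by rewrite (strip_rel_left (strip_repr_rel i)) strip_rel_refl.
Qed.

Lemma size_nodes i : 0 < size (Q i).1.2.
Proof.
rewrite -(badge_mult badgeQ (in_setT i)); apply/card_gt0P; exists i.
by rewrite !inE same_refl.
Qed.

Lemma card_copies i : #|copies (Q i)| = size (Q i).1.2.
Proof. exact: badge_mult badgeQ _ (in_setT i). Qed.

Lemma card_copies_bar i : #|copies (bar f (Q i))| = size (Q i).1.2.
Proof.
have [j _ sj] := badge_bar badgeQ (in_setT i).
have := same_size sj; rewrite /= size_map => ->; rewrite -card_copies.
apply: eq_card => k; rewrite !inE; apply/idP/idP => h; last exact: same_trans sj h.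
by apply: same_trans h; rewrite // same_sym.
Qed.

Lemma copies_disjoint i j : ~~ ((j \in copies (Q i)) && (j \in copies (bar f (Q i)))).
Proof.
rewrite !inE /=; apply/negP => /andP[h1 h2].
have /and4P[_ _ pq hv] := aapQ i.
have /negP[] := bar_not_same fK pq hv (size_nodes i).
by apply: same_trans h2 _; rewrite // same_sym.
Qed.

Lemma perm_copies : perm_eq (enum 'I_(size P))
  (flatten [seq enum (copies (Q (val e))) ++ enum (copies (bar f (Q (val e)))) |
             e <- enum {: strip}]).
Proof.
apply/allP => i _ /=; rewrite count_uniq_mem ?enum_uniq // mem_enum count_flatten.
rewrite sumnE !big_map.
rewrite (eq_bigr (fun e => if e == strip_of i then 1 else 0)) => [|e _].
  rewrite -big_mkcond sum1_count.
  by rewrite -enumT (count_uniq_mem (strip_of i) (enum_uniq _)) mem_enum.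
rewrite -strip_ofP count_cat !count_uniq_mem ?enum_uniq // !mem_enum.
have := copies_disjoint (val e) i; rewrite !inE /= /strip_rel.
by case: same; case: same.
Qed.

Lemma map_copies D (s : {set 'I_(size P)}) : (forall j, j \in s -> same f D (Q j)) ->
  [seq nth set0 P i | i : 'I_(size P) <- enum s] = nseq #|s| (edge_set F D).
Proof.
move=> h; rewrite cardE -(size_map (fun i : 'I_(size P) => nth set0 P i)).
apply/all_pred1P/allP => _ /mapP[j js ->] /=; rewrite mem_enum in js.
by rewrite edgeQ -(same_edge_set matchF (h j js)).
Qed.

Lemma badge_is_badge : size P = 2 * #|F| -> is_badge #|F| P.
Proof.
move=> zP.
have ends_sub (e : strip) : [set (Q (val e)).1.1; (Q (val e)).2] \subset [set v | f v == v].
  by have /and4P[/eqP fp /eqP fq _ _] := aapQ (val e);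
     apply/subsetP => v; rewrite !inE => /orP[]/eqP->; rewrite ?fp ?fq.
have ends_card (e : strip) : #|[set (Q (val e)).1.1; (Q (val e)).2]| = 2.
  by have /and4P[_ _ pq _] := aapQ (val e); rewrite cards2 pq.
have OSex (e : strip) : exists OS : origamistrip V, [/\ os_len OS = size (Q (val e)).1.2,
    os_x OS = (Q (val e)).1.1, os_y OS = (Q (val e)).2,
    os_interior OS = [set v | touches f (Q (val e)) v] &
    os_PA OS = edge_set F (Q (val e)) /\ os_PB OS = edge_set F (bar f (Q (val e)))].
  by apply: (strip_of_dipath matchF) => //; rewrite -size_eq0 -lt0n size_nodes.
have [OS hOS] := fin_all_exists OSex.
(* The vertices of [H] are all uncovered vertices; the interiors of strips consist of covered ones
   and therefore avoid them. *)
pose H := Multigraph ends_sub ends_card.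
pose w (e : mg_edge H) := size (Q (val e)).1.2.
have fam : perm_eq P (badge_family (H := H) w OS).
  have {1}-> : P = [seq nth set0 P i | i : 'I_(size P) <- enum 'I_(size P)].
    by rewrite (map_comp (nth set0 P) val) val_enum_ord -/(mkseq _ _) mkseq_nth.
  rewrite /badge_family.
  have -> : [seq nseq (w e) (os_PA (OS e)) ++ nseq (w e) (os_PB (OS e)) | e <- enum (mg_edge H)]
    = [seq [seq nth set0 P i | i : 'I_(size P) <- s] | s <-
       [seq enum (copies (Q (val e))) ++ enum (copies (bar f (Q (val e)))) | e <- enum {: strip}]].
    rewrite -[RHS]map_comp; apply: eq_map => e /=; rewrite map_cat.
    have [_ _ _ _ [-> ->]] := hOS e.
    rewrite (map_copies (D := Q (val e))) => [|j]; last by rewrite !inE.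
    rewrite (map_copies (D := bar f (Q (val e)))) => [|j]; last by rewrite !inE.
    by rewrite card_copies card_copies_bar.
  by rewrite -map_flatten; apply: perm_map perm_copies.
exists H, w, OS; split=> //.
- by move=> e; apply: size_nodes.
- split=> [e|e|e e' ee'|e]; have [h1 h2 h3 h4 _] := hOS e => //.
  + by rewrite h2 h3.
  + have [_ _ _ h4' _] := hOS e'; rewrite h4 h4'; apply/pred0P => v /=.
    rewrite !inE; apply/negP => /andP[t t'].
    have := badge_sep badgeQ (in_setT _) (in_setT _) t t'.
    rewrite -/(strip_rel _ _) strip_ofP => /eqP E; case/eqP: ee'.
    by apply: val_inj; rewrite E /= (eqP (valP e')).
  + rewrite h4; apply/pred0P => v /=; rewrite !inE; apply/negP => /andP[t fv].
    have /and4P[_ _ _ hv] := aapQ (val e).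
    by have := valid_active fK hv t; rewrite fv.
(* Each strip contributes twice its weight to the family, whose size is twice that of [F]; halving
   gives the sum of the weights. *)
- have := perm_size fam; rewrite zP size_flatten /shape -map_comp sumnE big_map.
  rewrite (eq_bigr (fun e => 2 * w e)) => [|e _]; last first.
    by rewrite /= size_cat !size_nseq addnn mul2n.
  rewrite -big_distrr /= => /eqP; rewrite eqn_pmul2l // => /eqP ->.
  by rewrite big_enum.
Qed.

End BadgeFamily.

Unset Implicit Arguments.

Theorem theorem3p1 (V : finType) (G : sgraph V) (F : {set {set V}}) (k : nat)
    (P : seq {set {set V}}) :
  matching G F -> #|F| = k ->
  (forall X, X \in P -> is_aap G F X) ->
  ~ (exists X, rainbow_aap G F P X) ->
  size P <= 2 * k /\ (size P = 2 * k -> is_badge k P).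
Proof.
move=> matchF <- aapP nor.
have exQ (i : 'I_(size P)) : exists D, [/\ aap (mate F) D, proper_links G F D &
    nth set0 P i = edge_set F D].
  by apply: aap_is_walk => //; apply: aapP; apply: mem_nth.
have [Q hQ] := fin_all_exists exQ.
have aQ i : aap (mate F) (Q i) by case: (hQ i).
have pQ i : proper_links G F (Q i) by case: (hQ i).
have eQ (i : 'I_(size P)) : nth set0 P i = edge_set F (Q i) by case: (hQ i).
have free : rainbow_free (mate F) Q [set: 'I_(size P)].
  move=> D aD hD; apply: nor; exists (edge_set F D).
  exact: (colourable_rainbow matchF pQ eQ aD hD).
have aC : {in [set: 'I_(size P)], forall i, aap (mate F) (Q i)} by move=> i _.
have cC : #|[set: 'I_(size P)]| = size P by rewrite cardsT card_ord.
have cA := card_active matchF; have fK := mateK matchF.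
have := card_colours_le fK aC free; rewrite cC cA => le; split=> // eP.
apply: (badge_is_badge matchF aQ eQ) => //.
by apply: rainbow_free_badge; rewrite // cC cA.
Qed.
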